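(* Let $\gamma\in[1/2,1)$ and let $f:\mathbb{R}_+\to\mathbb{R}_+$ satisfy $f(1)=1$ and, for all real $a,n\ge1$, $$a^{1/2}f(n)\le f(an)\le a^{\gamma}f(n).$$ Then there is a bounded sequence $m=(m_\ell)_{\ell\ge1}$ of integers $m_\ell\ge2$ such that the switch-walk-switch random walk $X_n$ on the permutation wreath product $\mathbb{Z}_2\wr_S\mathcal{M}_m$ satisfies $H(X_n)\asymp f(n)$ for integers $n\ge1$, with implied constants depending on $\gamma$ only; that is, there are constants $0<c\le C<\infty$ depending only on $\gamma$ with $cf(n)\le H(X_n)\le Cf(n)$ for all integers $n\ge1$.
   Context: $H(X)=-\sum_x\mathbf{P}(X=x)\log\mathbf{P}(X=x)$ is the Shannon entropy of a discrete random variable. $\mathbb{Z}_2$ is the group with two elements. Tree and groups. For a bounded sequence $m=(m_i)_{i\ge1}$ of integers $m_i\ge2$, let $\mathbb{T}_m$ be the rooted tree whose vertices are the finite words $w_k\cdots w_1$ with $w_i\in\{0,\dots,m_i-1\}$ (root: empty word), with edges $\{w_k\cdots w_1,\,w_{k-1}\cdots w_1\}$. Let $\tau m=(m_2,m_3,\dots)$. A rooted automorphism $\gamma$ of $\mathbb{T}_m$ is written $\gamma=\langle\gamma_0,\dots,\gamma_{m_1-1}\rangle\sigma$ with $\sigma\in\mathrm{Sym}(m_1)$ (the permutations of $\{0,\dots,m_1-1\}$) and $\gamma_i\in\mathrm{Aut}(\mathbb{T}_{\tau m})$; it acts on the right on left-infinite words by $(\cdots w_3w_2w_1).\gamma=\big((\cdots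 w_3w_2).\gamma_{w_1}\big)\,(w_1.\sigma)$. A permutation $\sigma\in\mathrm{Sym}(m_1)$ is identified with the automorphism $\langle id,\dots,id\rangle\sigma$. Given $\sigma_\ell\in\mathrm{Sym}(m_\ell)$ for all $\ell$, define recursively $a_\ell=\langle a_{\ell+1},\sigma_{\ell+1},\dots,\sigma_{\ell+1}\rangle\,id\in \mathrm{Aut}(\mathbb{T}_{\tau^{\ell-1}m})$; the automorphism $a_1$ of $\mathbb{T}_m$ is called a propagating action. Explicitly, if $i$ is the least index with $w_i\ne0$, then $a_1$ changes only the letter $w_{i+1}$, to $w_{i+1}.\sigma_{i+1}$, and $a_1$ fixes $\cdots000$. Let $\mathcal{H}$ be the finite group of all propagating actions for which $\sigma_\ell$ depends only on the value $m_\ell$ (i.e. $\sigma_\ell=\sigma_{\ell'}$ whenever $m_\ell=m_{\ell'}$). The piecewise mother group $\mathcal{M}_m$ is the group of automorphisms of $\mathbb{T}_m$ generated by $\mathcal{H}$ and $\mathrm{Sym}(m_1)$. It acts on the right on the set $S$ of left-infinite words $\cdots w_3w_2w_1$ with $w_i\in\{0,\dots,m_i-1\}$ and all but finitely many $w_i$ equal to $0$, with root $o=\cdots000$. Permutation wreath product. For a group $\Lambda$ and a group $\Gamma$ acting on the right on a set $S$ with root $o$, $\Lambda\wr_S\Gamma$ is the semidirect product of $\Lambda^S$ with $\Gamma$, with multiplication $(\ell,g)(\ell',g')=(\ell\,\ell'^{g^{-1}},gg')$, where $\ell'^{g^{-1}}(s)=\ell'(s.g)$. For $L\in\Lambda$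 let $\bar L$ denote the element $(\ell,id_\Gamma)$ with $\ell(o)=L$ and $\ell(s)=id_\Lambda$ for $s\ne o$. The switch-walk-switch random walk is $X_n=\prod_{i=1}^n\bar L_iG_i\bar L_i'$, where $G_i$ are i.i.d. from a fixed symmetric finitely supported measure on $\Gamma$, $L_i,L_i'$ are i.i.d. from a fixed symmetric finitely supported measure on $\Lambda$, and all are independent. Here $\Gamma=\mathcal{M}_m$, with $G_i$ distributed as the even mixture (weights $1/2,1/2$) of the uniform measures on $\mathrm{Sym}(m_1)$ and on $\mathcal{H}$; and $\Lambda=\mathbb{Z}_2$ with $L_i,L_i'$ uniform on $\mathbb{Z}_2$. *)

(* Defs.v *)
From HB Require Import structures.
From mathcomp Require Import all_boot all_order all_algebra.
From mathcomp Require Import fingroup perm finmap.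
From mathcomp Require Import all_classical all_reals all_analysis.

Set Implicit Arguments.
Unset Strict Implicit.
Unset Printing Implicit Defensive.

Import Order.TTheory GRing.Theory Num.Theory.

Local Open Scope classical_set_scope.
Local Open Scope group_scope.

(* Sequences are indexed from 0: [m i], [sigma i] and the letter of index [i]
   stand for m_(i+1), sigma_(i+1) and w_(i+1). *)
Record degseq : Type := DegSeq {
  deg :> nat -> nat;
  deg_ge2 : forall i, (2 <= deg i)%N;
  deg_bounded : exists B, forall i, (deg i <= B)%N }.

Definition shift (m : nat -> nat) : nat -> nat := fun i => m i.+1.

(* [Cons w_1 (w_k ... w_2)] is the vertex w_k ... w_1 of T_m, so the letters
   are read from the root. *)
Inductive word (m : nat -> nat) : Type :=
  | Root : word m
  | Cons : 'I_(m 0) -> word (shift m) -> word m.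

Arguments Root {m}.
Arguments Cons {m}.

(* w_k ... w_1 |-> w_(k-1) ... w_1, and the root is its own parent *)
Fixpoint parent (m : nat -> nat) (w : word m) : word m :=
  match w with
  | Root => Root
  | Cons x w' => match w' with Root => Root | _ => Cons x (parent w') end
  end.

Definition edge (m : nat -> nat) (u v : word m) : Prop :=
  (v <> Root /\ u = parent v) \/ (u <> Root /\ v = parent u).

Record aut (m : nat -> nat) : Type := Aut {
  aut_fun :> word m -> word m;
  aut_bij : bijective aut_fun;
  aut_root : aut_fun Root = Root;
  aut_edge : forall u v, edge (aut_fun u) (aut_fun v) <-> edge u v }.

HB.instance Definition _ m := gen_eqMixin (aut m).
HB.instance Definition _ m := gen_choiceMixin (aut m).

Lemma aut_ext m (g h : aut m) : aut_fun g =1 aut_fun h -> g = h.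
Proof.
case: g h => g bg rg eg [h bh rh eh] /= gh.
have {}gh : g = h by apply/funext.
subst h; congr Aut; exact: Prop_irrelevance.
Qed.

Section GroupAut.
Variable m : nat -> nat.
Implicit Types g h : aut m.

Definition aut_one : aut m.
Proof. by apply: (@Aut m id) => //; exists id. Defined.

(* automorphisms act on the right: g * h is g followed by h *)
Definition aut_mul g h : aut m.
Proof.
apply: (@Aut m (aut_fun h \o aut_fun g)).
- exact: bij_comp (aut_bij h) (aut_bij g).
- by rewrite /= !aut_root.
- by move=> u v /=; rewrite !aut_edge.
Defined.

Lemma aut_inv_ex g :
  exists f, cancel (aut_fun g) f /\ cancel f (aut_fun g).
Proof. by have [f] := aut_bij g; exists f. Qed.

Definition aut_inv_fun g := projT1 (cid (aut_inv_ex g)).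

Lemma aut_inv_funK g : cancel (aut_fun g) (aut_inv_fun g).
Proof. by rewrite /aut_inv_fun; case: cid => f []. Qed.

Lemma aut_inv_funVK g : cancel (aut_inv_fun g) (aut_fun g).
Proof. by rewrite /aut_inv_fun; case: cid => f []. Qed.

Definition aut_inv g : aut m.
Proof.
apply: (@Aut m (aut_inv_fun g)).
- by exists (aut_fun g); [exact: aut_inv_funVK|exact: aut_inv_funK].
- by rewrite -[in LHS](aut_root g) aut_inv_funK.
- by move=> u v; rewrite -(aut_edge g) !aut_inv_funVK.
Defined.

Lemma aut_mulA : associative aut_mul. Proof. by move=> f g h; exact: aut_ext. Qed.
Lemma aut_mul1 : left_id aut_one aut_mul. Proof. by move=> g; exact: aut_ext. Qed.
Lemma aut_mulr1 : right_id aut_one aut_mul. Proof. by move=> g; exact: aut_ext. Qed.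
Lemma aut_mulV : left_inverse aut_one aut_inv aut_mul.
Proof. by move=> g; apply: aut_ext => w /=; exact: aut_inv_funVK. Qed.
Lemma aut_mulrV : right_inverse aut_one aut_inv aut_mul.
Proof. by move=> g; apply: aut_ext => w /=; exact: aut_inv_funK. Qed.

End GroupAut.

HB.instance Definition _ m := isGroup.Build (aut m) (@aut_mulA m)
  (@aut_mul1 m) (@aut_mulr1 m) (@aut_mulV m) (@aut_mulrV m).

Lemma autM m (g h : aut m) w : (g * h) w = h (g w). Proof. by []. Qed.
Lemma aut1 m w : (1 : aut m) w = w. Proof. by []. Qed.

Fixpoint depth (m : nat -> nat) (w : word m) : nat :=
  if w is Cons _ w' then (depth w').+1 else 0.

Lemma depth_parent m (w : word m) : depth (parent w) = (depth w).-1.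
Proof. by elim: w => //= {}m x [|y w] //= ->. Qed.

Lemma depth0 m (w : word m) : depth w = 0 -> w = Root. Proof. by case: w. Qed.

Lemma aut_parent m (g : aut m) w : g (parent w) = parent (g w).
Proof.
move En: (depth w) => n; elim: n w En => [|n IHn] w En.
  by rewrite (depth0 En) /= aut_root.
have wN : w <> Root by move=> w0; rewrite w0 in En.
have dp : depth (parent w) = n by rewrite depth_parent En.
have : edge (g (parent w)) (g w) by apply/aut_edge; left.
case=> [[_ //]|[gpN gw]].
have := IHn _ dp; rewrite -gw => /(bij_inj (aut_bij g)) pw.
have := congr1 (@depth m) pw; rewrite depth_parent dp En.
by case: n {IHn En dp pw} => [|n] //= /eqP; rewrite ltn_eqF// ltnW.
Qed.

Lemma aut_depth m (g : aut m) w : depth (g w) = depth w.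
Proof.
move En: (depth w) => n; elim: n w En => [|n IHn] w En.
  by rewrite (depth0 En) /= aut_root.
have : depth (g (parent w)) = n by apply: IHn; rewrite depth_parent En.
rewrite aut_parent depth_parent.
case Eg: (g w) => [|x u] /=; last by move=> ->.
have := congr1 (aut_inv_fun g) Eg; rewrite aut_inv_funK.
by rewrite -{1}(aut_root g) aut_inv_funK => w0; rewrite w0 in En.
Qed.

Section ParentAut.
Variables (m : nat -> nat) (f f' : word m -> word m).
Hypotheses (fK : cancel f f') (f'K : cancel f' f).
Hypotheses (f0 : f Root = Root) (fp : forall w, f (parent w) = parent (f w)).

Lemma parent_aut_edge u v : edge (f u) (f v) <-> edge u v.
Proof.
have finj : injective f := can_inj fK.
have fN w : f w <> Root <-> w <> Root.
  by split=> + E; apply; [rewrite E|apply: finj; rewrite f0].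
have fE a b : f a = parent (f b) <-> a = parent b.
  by rewrite -fp; split=> [/finj|->].
by rewrite /edge !fN !fE.
Qed.

Definition parent_aut : aut m :=
  Aut (Bijective fK f'K) f0 parent_aut_edge.

End ParentAut.

(* <gamma_0, ..., gamma_(m_1 - 1)> sigma *)
Section Node.
Variable m : nat -> nat.
Implicit Types (gam : 'I_(m 0) -> aut (shift m)) (sigma : 'S_(m 0)).

Definition node_fun gam sigma (w : word m) : word m :=
  match w with Root => Root | Cons x w' => Cons (sigma x) (gam x w') end.

Lemma node_funK gam sigma : cancel (node_fun gam sigma)
  (node_fun (fun y => (gam (sigma^-1 y))^-1) sigma^-1).
Proof.
case=> //= x w; rewrite permK; congr Cons.
exact: (aut_inv_funK (gam x) w).
Qed.

Lemma node_funVK gam sigma :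
  cancel (node_fun (fun y => (gam (sigma^-1 y))^-1) sigma^-1)
    (node_fun gam sigma).
Proof.
case=> //= x w; rewrite permKV; congr Cons.
exact: (aut_inv_funVK (gam (sigma^-1 x)) w).
Qed.

Lemma node_fun_parent gam sigma w :
  node_fun gam sigma (parent w) = parent (node_fun gam sigma w).
Proof.
case: w => //= x [|y w] /=; first by rewrite aut_root.
rewrite (aut_parent (gam x) (Cons y w)).
by have := aut_depth (gam x) (Cons y w); case: (aut_fun (gam x) (Cons y w)).
Qed.

Definition node gam sigma : aut m :=
  parent_aut (node_funK gam sigma) (node_funVK gam sigma)
    (erefl : node_fun gam sigma Root = Root) (node_fun_parent gam sigma).

Definition rooted sigma : aut m := node (fun=> 1) sigma.

End Node.

Fixpoint prop_fun (m : nat -> nat) (sigma : forall i, 'S_(m i)) (w : word m) :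
    word m :=
  match w with
  | Root => Root
  | Cons x w' => Cons x
      (if x == 0 :> nat then @prop_fun (shift m) (fun i => sigma i.+1) w'
       else rooted (m := shift m) (sigma 1%N) w')
  end.

Lemma rootedK m (s : 'S_(m 0)) : cancel (rooted s) (rooted s^-1).
Proof. by case=> //= x w; rewrite permK. Qed.

Lemma prop_funK m (sigma : forall i, 'S_(m i)) :
  cancel (prop_fun sigma) (prop_fun (fun i => (sigma i)^-1)).
Proof.
move=> w; elim: w sigma => //= {}m x w IHw sigma; congr Cons.
case: ifP => ->; first exact: (IHw (fun i => sigma i.+1)).
  exact: (@rootedK (shift m)).
Qed.

Lemma prop_funVK m (sigma : forall i, 'S_(m i)) :
  cancel (prop_fun (fun i => (sigma i)^-1)) (prop_fun sigma).
Proof.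
have := @prop_funK m (fun i => (sigma i)^-1).
rewrite (_ : (fun i => (sigma i)^-1^-1) = sigma)//.
by apply: functional_extensionality_dep => i; rewrite invgK.
Qed.

Lemma prop_fun_depth m (sigma : forall i, 'S_(m i)) w :
  depth (prop_fun sigma w) = depth w.
Proof.
elim: w sigma => //= {}m x w IHw sigma; case: ifP => _; first by rewrite IHw.
by case: w {IHw}.
Qed.

Lemma prop_fun_parent m (sigma : forall i, 'S_(m i)) w :
  prop_fun sigma (parent w) = parent (prop_fun sigma w).
Proof.
elim: w sigma => //= {}m x w IHw sigma.
case: ifP => x0; last first.
  by case: w {IHw} => //= y [|z w] //=; rewrite x0.
have := IHw (fun i => sigma i.+1).
have := prop_fun_depth (fun i => sigma i.+1 : 'S_(shift m i)) w.
case: w {IHw} => [|y w] //.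
set u := prop_fun _ (Cons y w); case: u => // z u _ <-.
by rewrite [in LHS]/= x0.
Qed.

(* The propagating action a_1 of the sequence sigma; [propagatingE] is its
   defining recursion. *)
Definition propagating (m : nat -> nat) (sigma : forall i, 'S_(m i)) : aut m :=
  parent_aut (prop_funK sigma) (prop_funVK sigma)
    (erefl : prop_fun sigma Root = Root) (prop_fun_parent sigma).

Lemma propagatingE m (sigma : forall i, 'S_(m i)) :
  propagating sigma = node
    (fun x => if x == 0 :> nat
              then propagating (m := shift m) (fun i => sigma i.+1)
              else rooted (m := shift m) (sigma 1%N)) 1.
Proof. by apply: aut_ext => -[|x w] //=; rewrite perm1; case: ifP. Qed.

Lemma propagatingV m (sigma : forall i, 'S_(m i)) :
  (propagating sigma)^-1 = propagating (fun i => (sigma i)^-1).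
Proof.
apply: aut_ext => w; apply: (bij_inj (aut_bij (propagating sigma))).
by rewrite [LHS](aut_inv_funVK (propagating sigma)) /= prop_funVK.
Qed.

Lemma rootedV m (s : 'S_(m 0)) : (rooted s)^-1 = rooted s^-1.
Proof.
apply: aut_ext => w; apply: (bij_inj (aut_bij (rooted s))).
rewrite [LHS](aut_inv_funVK (rooted s)).
by rewrite -{1}(rootedK s^-1 w) invgK.
Qed.

Definition Sym_rooted (m : nat -> nat) : set (aut m) := range (@rooted m).

Definition value_dependent (m : nat -> nat) (sigma : forall i, 'S_(m i)) :=
  forall i j (e : m i = m j), cast_perm e (sigma i) = sigma j.

Definition Propagating (m : nat -> nat) : set (aut m) :=
  [set propagating sigma | sigma in @value_dependent m].

Lemma finite_Sym_rooted (m : nat -> nat) : finite_set (@Sym_rooted m).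
Proof. exact/finite_image/finite_finset. Qed.

Lemma finite_Propagating (m : degseq) : finite_set (@Propagating m).
Proof.
have [B mB] := deg_bounded m.
have mB' i : (m i < B.+1)%N by rewrite ltnS.
pose F (tau : {dffun forall k : 'I_B.+1, 'S_k}) : aut m :=
  propagating (fun i => tau (Ordinal (mB' i)) : 'S_(m i)).
apply: (@sub_finite_set _ _ (range F)); last first.
  exact/finite_image/finite_finset.
move=> _ [sigma sv <-].
pose t (k : 'I_B.+1) : 'S_k :=
  if pselect (exists i, m i = k) is left ex
  then cast_perm (projT2 (cid ex)) (sigma (projT1 (cid ex))) else 1.
exists [ffun k => t k] => //; congr propagating.
apply: functional_extensionality_dep => i; rewrite ffunE /t.
by case: pselect => [ex|[]]; [exact: sv|exists i].
Qed.

Definition generated (G : groupType) (A : set G) : set G :=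
  smallest (fun B : set G => group_closed (fun x => x \in B)) A.

Lemma generated_closed (G : groupType) (A : set G) :
  group_closed (fun x => x \in generated A).
Proof.
split; first by rewrite inE => B /= [[/set_mem]].
move=> x y; rewrite !inE => Ax Ay B /= BA; have [[_ BF] _] := BA.
by apply/set_mem/BF; apply/mem_set; [exact: Ax|exact: Ay].
Qed.

Definition mother_set (m : nat -> nat) : set (aut m) :=
  generated (@Propagating m `|` @Sym_rooted m).

Definition mother (m : nat -> nat) : Type := {g : aut m | g \in @mother_set m}.

HB.instance Definition _ m := SubChoice.on (mother m).
HB.instance Definition _ m := SubChoice_isSubGroup.Build (aut m) _ (mother m)
  (@generated_closed (aut m) (@Propagating m `|` @Sym_rooted m)).

(* Infinite words ... w_2 w_1, and the action of automorphisms on them: the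
   k first letters of x.g are those of (w_k ... w_1).g, see [truncA]. *)
Definition letters (m : nat -> nat) : Type := forall i, 'I_(m i).

Fixpoint trunc (k : nat) (m : nat -> nat) (x : letters m) : word m :=
  if k is k'.+1 then Cons (x 0) (@trunc k' (shift m) (fun i => x i.+1))
  else Root.

(* the letter of index i of w, and d if w is too short *)
Fixpoint letter_at (m : nat -> nat) (w : word m) (i : nat) : 'I_(m i) -> 'I_(m i) :=
  match w with
  | Root => id
  | Cons x w' =>
      match i return 'I_(m i) -> 'I_(m i) with
      | 0 => fun=> x
      | i'.+1 => @letter_at (shift m) w' i'
      end
  end.

Definition letters_act (m : nat -> nat) (x : letters m) (g : aut m) : letters m :=
  fun i => letter_at (g (trunc i.+1 x)) (x i).

Lemma depth_trunc k m (x : letters m) : depth (trunc k x) = k.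
Proof.
elim: k m x => //= k IHk m x; congr S.
exact: (IHk (shift m) (fun i => x i.+1)).
Qed.

Lemma parent_trunc k m (x : letters m) : parent (trunc k.+1 x) = trunc k x.
Proof.
elim: k m x => // k IHk m x; rewrite [RHS]/=.
by rewrite -(IHk (shift m) (fun i => x i.+1)).
Qed.

Lemma eq_trunc k m (x y : letters m) :
  (forall i, (i < k)%N -> x i = y i) -> trunc k x = trunc k y.
Proof.
elim: k m x y => //= k IHk m x y xy; rewrite xy//; congr Cons.
by apply: IHk => i ik; apply: xy.
Qed.

Lemma letter_at_trunc m (x : letters m) k i d :
  (i < k)%N -> letter_at (trunc k x) d = x i.
Proof.
by elim: k m x i d => // k IHk m x [|i] d //= ik; exact: (IHk (shift m)).
Qed.

Lemma trunc_letter_at m (u : word m) (d : letters m) :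
  trunc (depth u) (fun i => letter_at u (d i)) = u.
Proof.
elim: u d => //= {}m x w IHw d; congr Cons.
exact: (IHw (fun i => d i.+1)).
Qed.

Lemma letter_at_parent m (u : word m) i d :
  (i.+1 < depth u)%N -> letter_at (parent u) d = letter_at u d :> 'I_(m i).
Proof.
elim: u i d => //= {}m x [|y w] IHw [|i] d //= iw.
by rewrite -[RHS](IHw i d).
Qed.

Lemma truncA m (g : aut m) (x : letters m) k :
  trunc k (letters_act x g) = g (trunc k x).
Proof.
rewrite -[RHS](trunc_letter_at _ x) aut_depth depth_trunc.
apply: eq_trunc => i; rewrite /letters_act.
elim: k => // k IHk; rewrite ltnS leq_eqVlt => /orP[/eqP -> //|ik].
rewrite IHk// -parent_trunc aut_parent letter_at_parent//.
by rewrite aut_depth depth_trunc.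
Qed.

Lemma letters_act1 m (x : letters m) : letters_act x 1 = x.
Proof.
apply: functional_extensionality_dep => i.
by rewrite /letters_act aut1 letter_at_trunc.
Qed.

Lemma letter_at_default m (w : word m) i d d' :
  (i < depth w)%N -> letter_at w d = letter_at w d' :> 'I_(m i).
Proof. by elim: w i d d' => //= {}m x w IHw [|i] d d' //= iw; exact: IHw. Qed.

Lemma letters_actM m (x : letters m) g h :
  letters_act x (g * h) = letters_act (letters_act x g) h.
Proof.
apply: functional_extensionality_dep => i.
rewrite {1 2}/letters_act autM truncA; apply: letter_at_default.
by rewrite !aut_depth depth_trunc.
Qed.

Definition finsupp (m : nat -> nat) (x : letters m) :=
  exists N, forall i, (N <= i)%N -> x i = 0 :> nat.

Lemma finsupp_rooted m (s : 'S_(m 0)) x :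
  finsupp x -> finsupp (letters_act x (rooted s)).
Proof.
move=> [N xN]; exists N.+1 => -[//|i] Ni; rewrite -(xN i.+1) ?(ltnW Ni)//.
congr nat_of_ord; rewrite /letters_act/=.
exact: (@letter_at_trunc (shift m) (fun j => x j.+1) i.+1 i).
Qed.

Lemma prop_fun_origin m (sigma : forall i, 'S_(m i)) (x : letters m) k :
  (forall j, x j = 0 :> nat) -> prop_fun sigma (trunc k x) = trunc k x.
Proof.
elim: k m sigma x => //= k IHk m sigma x x0; rewrite x0 eqxx; congr Cons.
exact: (IHk (shift m) (fun i => sigma i.+1) _ (fun j => x0 j.+1)).
Qed.

Lemma prop_fun_letter m (sigma : forall i, 'S_(m i)) (x : letters m) N k i d :
  (forall j, (N <= j)%N -> x j = 0 :> nat) -> (N < i < k)%N ->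
  letter_at (prop_fun sigma (trunc k x)) d = x i.
Proof.
elim: N k m sigma x i d => [|N IHN] k m sigma x i d xN /andP[Ni ik].
  rewrite prop_fun_origin; first exact: letter_at_trunc.
  by move=> j; exact: xN.
case: i d Ni ik => [//|i] d Ni ik; case: k ik => [//|k] ik /=.
case: ifPn => x0.
  apply: (IHN k (shift m) (fun j => sigma j.+1) (fun j => x j.+1)).
    by move=> j Nj; apply: xN.
  by apply/andP.
case: i d Ni ik => [//|i] d Ni ik; case: k ik => [//|k] ik /=.
exact: (@letter_at_trunc (shift (shift m)) (fun j => x j.+2)).
Qed.

Lemma finsupp_propagating m (sigma : forall i, 'S_(m i)) x :
  finsupp x -> finsupp (letters_act x (propagating sigma)).
Proof.
move=> [N xN]; exists N.+1 => i Ni; rewrite -(xN i) ?(ltnW Ni)//.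
congr nat_of_ord; apply: prop_fun_letter xN _; rewrite Ni; exact: ltnSn.
Qed.

Lemma finsupp_mother m (g : mother m) x :
  finsupp x -> finsupp (letters_act x (val g)).
Proof.
pose B : set (aut m) := [set h | forall x, finsupp x ->
  finsupp (letters_act x h) /\ finsupp (letters_act x h^-1)].
suff : B (val g) by move=> /(_ x) /[apply] -[].
have /set_mem : val g \in @mother_set m by exact: valP.
apply; split; [split|].
- by rewrite inE => y yf; rewrite invg1 letters_act1.
- move=> h1 h2; rewrite !inE => B1 B2 y yf; rewrite invgF !letters_actM.
  by split; [exact: (B2 _ (B1 _ yf).1).2|exact: (B1 _ (B2 _ yf).1).2].
- move=> h [[sigma _ <-]|[s _ <-]] y yf.
    by rewrite propagatingV; split; exact: finsupp_propagating.
  by rewrite rootedV; split; exact: finsupp_rooted.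
Qed.

Record orbit_word (m : nat -> nat) : Type := OrbitWord {
  letter :> letters m;
  letter_finsupp : finsupp letter }.

Lemma orbit_word_ext m (x y : orbit_word m) : letter x = letter y -> x = y.
Proof.
case: x y => x xf [y yf] /= xy; subst y; congr OrbitWord.
exact: Prop_irrelevance.
Qed.

Definition origin (m : degseq) : orbit_word m.
Proof.
apply: (@OrbitWord m (fun i => Ordinal (ltnW (deg_ge2 m i)))).
by exists 0.
Defined.

Record right_action (G : groupType) (S : Type) : Type := RightAction {
  ract :> S -> G -> S;
  ract1 : forall s, ract s 1 = s;
  ractM : forall s g h, ract s (g * h) = ract (ract s g) h }.

Definition mother_act_fun (m : nat -> nat) (s : orbit_word m) (g : mother m) :
    orbit_word m :=
  OrbitWord (finsupp_mother g (letter_finsupp s)).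

Lemma mother_act1 m (s : orbit_word m) : mother_act_fun s 1 = s.
Proof. by apply: orbit_word_ext; exact: letters_act1. Qed.

Lemma mother_actM m (s : orbit_word m) g h :
  mother_act_fun s (g * h) = mother_act_fun (mother_act_fun s g) h.
Proof. by apply: orbit_word_ext; exact: letters_actM. Qed.

Definition mother_act (m : nat -> nat) : right_action (mother m) (orbit_word m) :=
  RightAction (@mother_act1 m) (@mother_actM m).

(* Lambda^S consists of all functions S -> Lambda, without support condition. *)
Record wreath (Lam Gam : groupType) (S : Type) (a : right_action Gam S) : Type :=
  Wreath { lamps : S -> Lam; base : Gam }.

Section WreathGroup.
Variables (Lam Gam : groupType) (S : Type) (a : right_action Gam S).
Local Notation W := (@wreath Lam Gam S a).
Implicit Types x y : W.

HB.instance Definition _ := gen_eqMixin W.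
HB.instance Definition _ := gen_choiceMixin W.

Definition wreath_one : W := Wreath a (fun=> 1) 1.

Definition wreath_mul x y : W :=
  Wreath a (fun s => lamps x s * lamps y (a s (base x))) (base x * base y).

Definition wreath_inv x : W :=
  Wreath a (fun s => (lamps x (a s (base x)^-1))^-1) (base x)^-1.

Lemma wreath_ext x y : lamps x =1 lamps y -> base x = base y -> x = y.
Proof. by case: x y => l g [k h] /= /funext -> ->. Qed.

Lemma wreath_mulA : associative wreath_mul.
Proof.
by move=> x y z; apply: wreath_ext => [s|] /=; rewrite ?ractM mulgA.
Qed.

Lemma wreath_mul1 : left_id wreath_one wreath_mul.
Proof. by move=> x; apply: wreath_ext => [s|] /=; rewrite ?ract1 mul1g. Qed.

Lemma wreath_mulr1 : right_id wreath_one wreath_mul.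
Proof. by move=> x; apply: wreath_ext => [s|] /=; rewrite mulg1. Qed.

Lemma wreath_mulV : left_inverse wreath_one wreath_inv wreath_mul.
Proof. by move=> x; apply: wreath_ext => [s|] /=; rewrite mulVg. Qed.

Lemma wreath_mulrV : right_inverse wreath_one wreath_inv wreath_mul.
Proof.
move=> x; apply: wreath_ext => [s|] /=; rewrite -?ractM mulgV//.
by rewrite ract1 mulgV.
Qed.

HB.instance Definition _ := isGroup.Build W wreath_mulA wreath_mul1
  wreath_mulr1 wreath_mulV wreath_mulrV.

Definition lamp_at (o : S) (l : Lam) : W :=
  Wreath a (fun s => if `[< s = o >] then l else 1) 1.

Definition of_base (g : Gam) : W := Wreath a (fun=> 1) g.

End WreathGroup.

Section Probability.
Local Open Scope ring_scope.
Local Open Scope ereal_scope.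
Variables (R : realType) (d : measure_display) (T : measurableType d).
Variable P : probability T R.

(* X is a discrete random variable (measurable for the discrete
   sigma-algebra on E) whose probability mass function is p *)
Definition has_law (E : Type) (X : T -> E) (p : E -> R) : Prop :=
  (forall A : set E, measurable (X @^-1` A)) /\
  (forall x, P (X @^-1` [set x]) = (p x)%:E).

Definition discrete_sigma (E : Type) (X : T -> E) : set_system T :=
  preimage_set_system setT X [set: set E].

Definition mutually_independent (I : eqType) (F : I -> set_system T) : Prop :=
  forall (J : seq I) (A : I -> set T), uniq J ->
    (forall i, i \in J -> F i (A i)) ->
    P (\bigcap_(i in [set` J]) A i) = \prod_(i <- J) P (A i).

Definition entropy (E : choiceType) (X : T -> E) : \bar R :=
  \esum_(x in [set: E])
    (let p := fine (P (X @^-1` [set x])) in (- (p * ln p))%R)%:E.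

Record sws_steps (Lam Gam : groupType) (lam : Lam -> R) (nu : Gam -> R)
    (L : nat -> T -> Lam) (G : nat -> T -> Gam) (L' : nat -> T -> Lam) : Prop :=
  SwsSteps {
    sws_L : forall i, has_law (L i) lam;
    sws_G : forall i, has_law (G i) nu;
    sws_L' : forall i, has_law (L' i) lam;
    sws_indep : mutually_independent (fun j : nat + nat + nat =>
      match j with
      | inl (inl i) => discrete_sigma (L i)
      | inl (inr i) => discrete_sigma (G i)
      | inr i => discrete_sigma (L' i)
      end) }.

End Probability.

(* The factor of index i is the (i+1)-st step. *)
Definition sws_walk (Lam Gam : groupType) (S : Type) (a : right_action Gam S)
    (o : S) (T : Type) (L : nat -> T -> Lam) (G : nat -> T -> Gam)
    (L' : nat -> T -> Lam) (n : nat) (t : T) : wreath Lam a :=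
  \prod_(i < n)
    (lamp_at a o (L i t) * of_base Lam a (G i t) * lamp_at a o (L' i t)).

Section Laws.
Local Open Scope ring_scope.
Variable R : realType.

(* Meaningful for finite nonempty A only: [fset_set A] is empty when A is
   infinite. *)
Definition uniform_on (E : choiceType) (A : set E) (x : E) : R :=
  if x \in A then (#|` fset_set A|)%:R^-1 else 0.

Definition mother_law (m : nat -> nat) (g : mother m) : R :=
  2^-1 * uniform_on (val @^-1` @Sym_rooted m) g +
  2^-1 * uniform_on (val @^-1` @Propagating m) g.

End Laws.

(* Main.v *)
From Pilot Require Import Defs.
From HB Require Import structures.
From mathcomp Require Import all_boot all_order all_algebra.
From mathcomp Require Import fingroup perm finmap.
From mathcomp Require Import all_classical all_reals all_analysis.
From mathcomp Require Import ring lra zify.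

(** The degrees are [2] and one large [M], in an order chosen greedily, and both
    entropy bounds come from following the word of increments of the walk down the
    tree.

    A particle at a vertex [v] of the first level reads its own word, the section
    at [v]: rooted letters only move it, and a propagating letter acts below as a
    propagating letter if it finds the particle at [0], and as a rooted one
    otherwise. Neighbouring letters of the same kind merge, so the length of a word
    is measured by its number of rises, the propagating letters that directly
    follow a rooted one. Between two such letters the position of the particle is
    refreshed uniformly; hence a level of degree [m] multiplies the mean number of
    rises by [(m - 1) / m ^ 2], up to a loss of at most one rise, and the second
    factorial moment by at most the square of this ([thinning_rises_le],
    [thinning_rises_ge], [thinning_fact2_le]). The permutation of a letter moves
    particles on one level only, so that this can be iterated
    ([avg_seeds_sec_from]). After [n] steps, a vertex of level [k] therefore sees
    about [n / scale k] rises, where [scale k] is the product of the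
    [m_i ^ 2 / (m_i - 1)] over the first [k] levels.

    Upper bound. The element reached by the walk is encoded by its tree of
    sections, cut where a word has no rise: such a word is a product of propagating
    actions followed by rooted permutations, and takes one symbol of a finite
    alphabet ([leafP], [code_inj]). Below the level with [scale k] comparable to [n]
    the number of vertices grows more slowly than the number of rises at a vertex
    decreases, so the mean length of the code is at most of the order of the number
    [width k] of vertices of that level ([mean_code]). Entropy is at most a constant
    times the mean length of a code ([fentropy_code]).

    Lower bound. By the second moment method a positive fraction of the vertices of
    this same level see a rise ([mean_alive]). Below each of them there is a site
    whose lamp has been changed, and given the increments in the mother group the
    probability of a lamp configuration is at most [2] to the minus the number of
    such vertices ([avg_lamps_le], [fentropy_cond]).

    So the entropy at time [n] is comparable to [width k] when [scale k] is
    comparable to [n]. A level of degree [2] multiplies the scale by [4] and the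
    width by [2], which is the slope [1 / 2]; a level of degree [M] multiplies the
    width by [M], which is at least the power [gamma] of the factor of the scale
    ([large_degree]). Taking degree [M] whenever the width is behind [f] and degree
    [2] otherwise keeps [width k] comparable to [f (scale k)] ([greedy_width]).

    Finally, the walk has the law of a function on a finite uniform space of coins,
    seeds and lamps ([walk_law]), so that its entropy is a finite average. *)

Set Implicit Arguments.
Unset Strict Implicit.
Unset Printing Implicit Defensive.
Import Order.TTheory GRing.Theory Num.Theory.
Local Open Scope ring_scope.

(** * Averages over finite types *)

Section Average.
Variable R : realType.

Definition avg (A : finType) (F : A -> R) : R := #|A|%:R^-1 * \sum_a F a.

Implicit Types A B : finType.

Lemma eq_avg A (F G : A -> R) : F =1 G -> avg F = avg G.
Proof. by move=> FG; rewrite /avg (eq_bigr G). Qed.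

Lemma avgD A (F G : A -> R) : avg (fun a => F a + G a) = avg F + avg G.
Proof. by rewrite /avg big_split mulrDr. Qed.

Lemma avgZ A c (F : A -> R) : avg (fun a => c * F a) = c * avg F.
Proof. by rewrite /avg -mulr_sumr mulrCA. Qed.

Lemma ler_avg A (F G : A -> R) : (forall a, F a <= G a) -> avg F <= avg G.
Proof. by move=> FG; rewrite ler_wpM2l// ?invr_ge0//; apply: ler_sum. Qed.

Lemma avg_cst A c : (0 < #|A|)%N -> avg (fun _ : A => c) = c.
Proof.
move=> A0; rewrite /avg sumr_const -[X in _ * X]mulr_natl mulrA mulVf ?mul1r//.
by rewrite pnatr_eq0 -lt0n.
Qed.

Lemma avg_ge0 A (F : A -> R) : (forall a, 0 <= F a) -> 0 <= avg F.
Proof. by move=> F0; rewrite mulr_ge0 ?invr_ge0//; apply: sumr_ge0. Qed.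

Lemma avg_sum A I (r : seq I) (F : I -> A -> R) :
  avg (fun a => \sum_(i <- r) F i a) = \sum_(i <- r) avg (F i).
Proof. by rewrite /avg exchange_big mulr_sumr. Qed.

Lemma exchange_avg A B (F : A -> B -> R) :
  avg (fun a => avg (F a)) = avg (fun b => avg (F^~ b)).
Proof. by rewrite [RHS]/avg -[X in _ * X]avg_sum -avgZ. Qed.

Lemma avg_pair A B (F : A * B -> R) :
  avg F = avg (fun a => avg (fun b => F (a, b))).
Proof.
rewrite {1}/avg card_prod natrM invfM -mulrA [in RHS]/avg; congr (_ * _).
rewrite mulr_sumr; under [RHS]eq_bigr do rewrite /avg mulr_sumr.
by rewrite pair_bigA; apply: eq_bigr => -[].
Qed.

Lemma avg_bij A B (h : A -> B) (F : B -> R) :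
  bijective h -> avg (fun a => F (h a)) = avg F.
Proof.
move=> bh; rewrite /avg (bij_eq_card bh) [in RHS](reindex h)//.
exact: onW_bij.
Qed.

Lemma avg_bool (F : bool -> R) : avg F = 2^-1 * (F true + F false).
Proof. by rewrite /avg card_bool big_bool. Qed.

(** The recursion matches words that are read letter by letter; [avgnE] identifies
    it with the average over tuples. *)
Fixpoint avgn (A : finType) (n : nat) (F : seq A -> R) : R :=
  if n is n'.+1 then avg (fun a => avgn n' (fun s => F (a :: s))) else F [::].

Lemma avgnE A n (F : seq A -> R) : avgn n F = avg (fun t : n.-tuple A => F t).
Proof.
elim: n F => [|n IHn] F /=.
  rewrite /avg card_tuple expn0 invr1 mul1r (bigD1 [tuple])//= big1 ?addr0//.
  by move=> t; rewrite tuple0.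
rewrite (eq_avg (fun a => IHn _)) -(avg_pair (fun x : A * n.-tuple A => F (x.1 :: x.2))).
rewrite -(@avg_bij _ _ (fun x : A * n.-tuple A => cons_tuple x.1 x.2))//.
exists (fun t => (thead t, behead_tuple t)).
  by move=> [a t] /=; congr pair; apply: val_inj.
by move=> t; rewrite [RHS]tuple_eta; apply: val_inj.
Qed.

Lemma eq_avgn A n (F G : seq A -> R) :
  (forall s, size s = n -> F s = G s) -> avgn n F = avgn n G.
Proof. by move=> FG; rewrite !avgnE; apply: eq_avg => t; rewrite FG ?size_tuple. Qed.

Lemma ler_avgn A n (F G : seq A -> R) :
  (forall s, size s = n -> F s <= G s) -> avgn n F <= avgn n G.
Proof. by move=> FG; rewrite !avgnE; apply: ler_avg => t; rewrite FG ?size_tuple. Qed.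

Lemma avgnZ A n c (F : seq A -> R) : avgn n (fun s => c * F s) = c * avgn n F.
Proof. by rewrite !avgnE avgZ. Qed.

Lemma avgn_cst A n c : (0 < #|A|)%N -> avgn n (fun _ : seq A => c) = c.
Proof. by move=> A0; rewrite avgnE avg_cst// card_tuple expn_gt0 A0. Qed.

End Average.

(** * Entropy on a finite uniform probability space *)

Section FiniteEntropy.
Variable R : realType.
Implicit Types (O : finType) (D : eqType).

Definition pmf O D (X : O -> D) (x : D) : R := avg (fun w => (X w == x)%:R).

Definition fentropy O D (X : O -> D) : R := avg (fun w => - ln (pmf X (X w))).

Definition values O D (X : O -> D) : seq D := undup (map X (enum O)).

Lemma mem_values O D (X : O -> D) w : X w \in values X.
Proof. by rewrite mem_undup map_f ?mem_enum. Qed.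

Lemma pmf_ge0 O D (X : O -> D) x : 0 <= pmf X x.
Proof. by apply: avg_ge0 => w; case: eqP. Qed.

Lemma pmf_gt0 O D (X : O -> D) w : 0 < pmf X (X w).
Proof.
have O0 : (0 < #|O|)%N by apply/card_gt0P; exists w.
rewrite /pmf /avg mulr_gt0 ?invr_gt0 ?ltr0n//.
rewrite (bigD1 w)//= eqxx ltr_pwDl//; apply: sumr_ge0 => v _.
by case: eqP.
Qed.

Lemma pmf_eq0 O D (X : O -> D) x : x \notin values X -> pmf X x = 0.
Proof.
move=> xX; rewrite /pmf /avg big1 ?mulr0// => w _.
by case: eqP => // Xw; rewrite -Xw mem_values in xX.
Qed.

Lemma avg_values O D (X : O -> D) (g : D -> R) :
  avg (fun w => g (X w)) = \sum_(x <- values X) pmf X x * g x.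
Proof.
under [in RHS]eq_bigr do rewrite mulrC -avgZ.
rewrite -avg_sum; apply: eq_avg => w.
rewrite (bigD1_seq (X w)) ?mem_values ?undup_uniq//= eqxx mulr1 big1 ?addr0//.
by move=> x /negPf; rewrite eq_sym => ->; rewrite mulr0.
Qed.

(** Each value [x] is taken with frequency [pmf X x], so the weight [1 / pmf X]
    counts every value once. *)
Lemma avg_div_pmf O D (X : O -> D) (g : D -> R) :
  avg (fun w => g (X w) / pmf X (X w)) = \sum_(x <- values X) g x.
Proof.
rewrite (avg_values X (fun x => g x / pmf X x)) big_seq [RHS]big_seq.
apply: eq_bigr => x; rewrite mem_undup => /mapP[w _ ->].
by rewrite mulrC divfK// gt_eqF// pmf_gt0.
Qed.

Lemma sum_pmf_le1 O D (X : O -> D) s :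
  (0 < #|O|)%N -> uniq s -> \sum_(x <- s) pmf X x <= 1.
Proof.
move=> O0 us; rewrite -avg_sum -[leRHS](avg_cst (A := O))//.
apply: ler_avg => w; have [ws|ws] := boolP (X w \in s).
  rewrite (bigD1_seq (X w))//= eqxx big1 ?addr0//.
  by move=> x /negPf; rewrite eq_sym => ->.
rewrite big_seq big1// => x xs; case: eqP => // Xw.
by rewrite Xw xs in ws.
Qed.

Lemma fentropyE O D (X : O -> D) :
  fentropy X = \sum_(x <- values X) - (pmf X x * ln (pmf X x)).
Proof.
rewrite /fentropy (avg_values X (fun x => - ln (pmf X x))).
by apply: eq_bigr => x _; rewrite mulrN.
Qed.

(** Values of [Y] refine those of [X], so the value of [X] has at least the
    probability of the value of [Y]. *)
Lemma fentropy_coarse O D D' (X : O -> D) (Y : O -> D') :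
  (forall w w', Y w = Y w' -> X w = X w') -> fentropy X <= fentropy Y.
Proof.
move=> YX; apply: ler_avg => w; rewrite lerN2 ler_ln ?posrE ?pmf_gt0//.
apply: ler_avg => v; case: (eqVneq (Y v)) => [/YX ->|]; first by rewrite eqxx.
by case: eqP.
Qed.

(** A sequence of length [N] gets weight [(2 #|A|)^-N / 2]; there are at most
    [#|A|^N] of them, so length [N] contributes at most [2^-(N+1)]. *)
Lemma kraft (A : finType) (s : seq (seq A)) : uniq s ->
  \sum_(c <- s) (2 * #|A|%:R : R) ^- (size c) * 2^-1 <= 1.
Proof.
move=> us; pose B := (\max_(c <- s) size c)%N.
have sB c : c \in s -> (size c < B.+1)%N.
  by move=> cs; rewrite ltnS /B; apply: (@leq_bigmax_seq _ _ xpredT size).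
have -> : \sum_(c <- s) (2 * #|A|%:R : R) ^- (size c) * 2^-1 =
    \sum_(N < B.+1) \sum_(c <- s | size c == N) (2 * #|A|%:R : R) ^- N * 2^-1.
  rewrite (exchange_big_dep xpredT)//= big_seq [RHS]big_seq.
  apply: eq_bigr => c /sB cB.
  rewrite (bigD1 (Ordinal cB))//= big1 ?addr0// => i /andP[/eqP e].
  by rewrite -val_eqE /= e eqxx.
apply: (@le_trans _ _ (\sum_(N < B.+1) 2 ^- N * 2^-1)); last first.
  suff -> : forall k, \sum_(N < k) (2 : R) ^- N * 2^-1 = 1 - 2 ^- k.
    by rewrite lerBlDr lerDl invr_ge0 exprn_ge0.
  elim=> [|k IH]; first by rewrite big_ord0 expr0 invr1 subrr.
  rewrite big_ord_recr /= IH exprS invfM mulrC -addrA; congr (_ + _).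
  by set u := 2 ^- k; lra.
apply: ler_sum => N _; rewrite -mulr_suml ler_wpM2r ?invr_ge0//.
rewrite big_const_seq iter_addr_0.
have cN : (count (fun c => size c == N) s <= #|A| ^ N)%N.
  rewrite -size_filter -card_tuple cardE.
  rewrite -(size_map (@tval N A)); apply: uniq_leq_size.
    exact: filter_uniq.
  move=> c; rewrite mem_filter => /andP[cN _]; apply/mapP.
  by exists (Tuple cN) => //; rewrite mem_enum.
apply: (@le_trans _ _ ((2 * #|A|%:R) ^- N *+ (#|A| ^ N)%N)).
  by apply: ler_wpMn2l => //; rewrite invr_ge0 exprn_ge0// mulr_ge0.
rewrite exprMn invfM -[X in X <= _]mulr_natr natrX -mulrA.
have [->|A0] := eqVneq (#|A|%:R : R) 0.
  case: (N : nat) => [|k]; first by rewrite !expr0 invr1 !mulr1.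
  by rewrite expr0n /= !mulr0 invr_ge0 exprn_ge0.
by rewrite mulVf ?mulr1// expf_neq0.
Qed.

Lemma ln_sub1 (x : R) : 0 < x -> ln x <= x - 1.
Proof.
move=> x0; rewrite -{1}(subrKC 1 x); apply: le_ln1Dx.
by rewrite ltrBrDl subrr.
Qed.

(** Gibbs' inequality against the subprobability of [kraft], which gives a code
    of length [N] a cost of [N ln (2 #|A|) + ln 2]. The codes need not be prefix
    free. *)
Lemma fentropy_code O D (A : finType) (X : O -> D) (code : O -> seq A) :
  (0 < #|O|)%N -> (0 < #|A|)%N ->
  (forall w w', code w = code w' -> X w = X w') ->
  fentropy X <= ln (2 * #|A|%:R) * avg (fun w => (size (code w))%:R) + ln 2.
Proof.
move=> O0 A0 cX; apply: (le_trans (fentropy_coarse cX)).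
have A0' : 0 < (#|A|%:R : R) by rewrite ltr0n.
pose q (c : seq A) : R := (2 * #|A|%:R) ^- size c * 2^-1.
have q0 c : 0 < q c.
  by rewrite mulr_gt0 ?invr_gt0// exprn_gt0// mulr_gt0.
rewrite -avgZ -[X in _ + X](@avg_cst _ O)// -avgD.
rewrite -subr_le0 -[X in _ - X]mul1r -mulNr -avgZ -avgD.
apply: (@le_trans _ _ (avg (fun w => q (code w) / pmf code (code w) - 1))).
  apply: ler_avg => w; have p0 := pmf_gt0 code w.
  have : ln (q (code w) / pmf code (code w)) = - ln (pmf code (code w)) -
      (ln (2 * #|A|%:R) * (size (code w))%:R + ln 2).
    have A2 : 0 < (2 * #|A|%:R : R) by rewrite mulr_gt0.
    have lnq : ln (q (code w)) = - (ln (2 * #|A|%:R) * (size (code w))%:R + ln 2).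
      rewrite [LHS]lnM ?posrE ?invr_gt0 ?exprn_gt0//.
      rewrite !lnV ?posrE ?exprn_gt0// lnXn// -[X in - X - _]mulr_natr.
      by rewrite opprD.
    by rewrite ln_div ?posrE// lnq addrC.
  rewrite mulN1r => <-; apply: ln_sub1; exact: divr_gt0.
rewrite avgD avg_div_pmf avg_cst// subr_le0.
exact/kraft/undup_uniq.
Qed.

(** Conditioning on [y] only decreases the entropy: this is Jensen, here through
    [ln u <= u - 1] at [u = pmf X x / pmf (X (y, _)) x]. Given [y], no value has
    probability more than [2^-(N y)], which leaves an entropy of at least
    [N y ln 2]. *)
Lemma fentropy_cond (Y L : finType) D (X : Y * L -> D) (N : Y -> nat) :
  (0 < #|Y|)%N -> (0 < #|L|)%N ->
  (forall y x, pmf (fun l => X (y, l)) x <= 2 ^- N y) ->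
  ln 2 * avg (fun y => (N y)%:R) <= fentropy X.
Proof.
move=> Y0 L0 XN; rewrite /fentropy avg_pair -avgZ; apply: ler_avg => y.
pose p := pmf (fun l => X (y, l)).
have -> : ln 2 * (N y)%:R = ln 2 * (N y)%:R + 1 - 1 :> R by rewrite addrK.
apply: (@le_trans _ _ (avg (fun l => (ln 2 * (N y)%:R + 1) -
    pmf X (X (y, l)) / p (X (y, l))))).
  rewrite avgD avg_cst// lerD2l.
  under eq_avg do rewrite -mulN1r.
  rewrite avgZ mulN1r lerN2 (avg_div_pmf (fun l => X (y, l))).
  by apply: sum_pmf_le1; rewrite ?undup_uniq// card_prod muln_gt0 Y0.
apply: ler_avg => l.
have p0 : 0 < p (X (y, l)) := pmf_gt0 (fun l => X (y, l)) l.
have q0 := pmf_gt0 X (y, l).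
have /ln_sub1 : 0 < pmf X (X (y, l)) / p (X (y, l)) by exact: divr_gt0.
rewrite ln_div ?posrE//.
have : ln (p (X (y, l))) <= ln (2 ^- N y).
  by rewrite ler_ln ?posrE ?invr_gt0 ?exprn_gt0//; exact: XN.
rewrite lnV ?posrE ?exprn_gt0// lnXn// -[X in _ <= - X]mulr_natr.
by lra.
Qed.

End FiniteEntropy.

(** * How the pattern of a word is thinned by one level of the tree *)

Section Blocks.
Variable R : realType.

(** A pattern of a word records [true] for a propagating letter and [false] for a
    rooted one. [rises true kap] counts the propagating letters that directly
    follow a rooted one; it vanishes exactly for the patterns
    [true .. true false .. false]. The argument [c] is the letter read before
    [kap]. *)
Fixpoint rises (c : bool) (kap : seq bool) : nat :=
  if kap is d :: kap' then (~~ c && d) + rises d kap' else 0.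

Lemma rises_true_false kap : (rises true kap <= rises false kap)%N.
Proof. by case: kap => //= d kap; rewrite leq_addl. Qed.

Definition fact2 (n : nat) : R := (n * n.-1)%:R.

Lemma fact2S n : fact2 n.+1 = fact2 n + 2 * n%:R.
Proof. by rewrite /fact2 -natrM -natrD; congr _%:R; case: n => //= n; lia. Qed.

Lemma ler_fact2 n k : (n <= k)%N -> fact2 n <= fact2 k.
Proof. by move=> nk; rewrite ler_nat leq_mul// -!subn1 leq_sub2r. Qed.

Section Thinning.
Variable m : nat.
Hypothesis m_gt1 : (1 < m)%N.

Definition is_zero (x : 'I_m) : bool := x == 0 :> nat.

(** The random pattern of the section of a word of pattern [kap] at a first letter
    [x]: a propagating letter survives, as propagating if the current position is
    [0] and as rooted otherwise; a rooted letter disappears and moves the position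
    to a uniform place. The value is the expectation of [Psi] at this random
    pattern. *)
Fixpoint thinning_from (x : 'I_m) (kap : seq bool) (Psi : seq bool -> R) : R :=
  match kap with
  | [::] => Psi [::]
  | true :: kap' => thinning_from x kap' (fun k => Psi (is_zero x :: k))
  | false :: kap' => avg (fun y => thinning_from y kap' Psi)
  end.

Definition thinning kap Psi := avg (fun x => thinning_from x kap Psi).

Lemma eq_thinning_from x kap Psi Psi' : Psi =1 Psi' ->
  thinning_from x kap Psi = thinning_from x kap Psi'.
Proof. by move=> /funext ->. Qed.

Lemma thinning_fromD x kap F G :
  thinning_from x kap (fun k => F k + G k) = thinning_from x kap F + thinning_from x kap G.
Proof.
elim: kap x F G => //= -[] kap IH x F G; first exact: IH.
by rewrite -avgD; apply: eq_avg => y; exact: IH.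
Qed.

Lemma thinning_fromZ x kap c F :
  thinning_from x kap (fun k => c * F k) = c * thinning_from x kap F.
Proof.
elim: kap x F => //= -[] kap IH x F; first exact: IH.
by rewrite -avgZ; apply: eq_avg => y; exact: IH.
Qed.

Lemma ord_gt0 : (0 < #|'I_m|)%N. Proof. by rewrite card_ord ltnW. Qed.

Lemma thinning_from_cst x kap c : thinning_from x kap (fun=> c) = c.
Proof.
elim: kap x => //= -[] kap IH x; first exact: IH.
by under eq_avg do rewrite IH; rewrite avg_cst// ord_gt0.
Qed.

Lemma ler_thinning_from x kap F G : (forall k, F k <= G k) ->
  thinning_from x kap F <= thinning_from x kap G.
Proof.
elim: kap x F G => //= -[] kap IH x F G FG; first exact: IH.
by apply: ler_avg => y; exact: IH.
Qed.

Lemma thinning_from_avg (A : finType) x kap (F : A -> seq bool -> R) :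
  thinning_from x kap (fun k => avg (F^~ k)) = avg (fun a => thinning_from x kap (F a)).
Proof.
elim: kap x F => //= -[] kap IH x F; first exact: IH.
by rewrite [RHS]exchange_avg; apply: eq_avg => y; exact: IH.
Qed.

Lemma thinningD kap F G : thinning kap (fun k => F k + G k) = thinning kap F + thinning kap G.
Proof. by rewrite -avgD; apply: eq_avg => x; exact: thinning_fromD. Qed.

Lemma thinningZ kap c F : thinning kap (fun k => c * F k) = c * thinning kap F.
Proof. by rewrite -avgZ; apply: eq_avg => x; exact: thinning_fromZ. Qed.

Lemma thinning_cst kap c : thinning kap (fun=> c) = c.
Proof.
by rewrite -[RHS](avg_cst c ord_gt0); apply: eq_avg => x; exact: thinning_from_cst.
Qed.

Lemma thinning_nil F : thinning [::] F = F [::].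
Proof. by rewrite /thinning /= avg_cst// ord_gt0. Qed.

Lemma ler_thinning kap F G : (forall k, F k <= G k) -> thinning kap F <= thinning kap G.
Proof. by move=> FG; apply: ler_avg => x; exact: ler_thinning_from. Qed.

Local Notation p := (m%:R^-1 : R).

(** Between two propagating letters separated by a rooted one the position is
    refreshed, so the section has a rise there if the first position is nonzero
    and the second is zero. This value is [(m - 1) / m ^ 2]. *)
Definition rise_rate : R := p * (1 - p).

Lemma invm_bounds : 0 < p <= 2^-1.
Proof. by rewrite invr_gt0 lef_pV2 ?posrE ?ltr0n ?ler_nat//; lia. Qed.

Lemma rise_rate_gt0 : 0 < rise_rate.
Proof. by have /andP[p0 p1] := invm_bounds; rewrite mulr_gt0// subr_gt0; lra. Qed.

Lemma rise_rate_le : rise_rate <= 4^-1.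
Proof. by rewrite /rise_rate; have := sqr_ge0 (p - 2^-1); rewrite expr2; lra. Qed.

Lemma avg_is_zero_mul (z : 'I_m) (G : 'I_m -> R) : is_zero z ->
  avg (fun x => (is_zero x)%:R * G x) = p * G z.
Proof.
move=> z0; rewrite /avg card_ord (bigD1 z)//= z0 mul1r big1 ?addr0// => x xz.
case xx: (is_zero x); rewrite ?mul0r//; case/eqP: xz; apply: val_inj.
by rewrite /= (eqP xx) (eqP z0).
Qed.

Definition zero_ord : 'I_m := Ordinal (ltnW m_gt1).

Lemma avg_is_zero (h : bool -> R) :
  avg (fun x => h (is_zero x)) = p * h true + (1 - p) * h false.
Proof.
under eq_avg => x.
  have -> : h (is_zero x) = (is_zero x)%:R * (h true - h false) + h false.
    by case: (is_zero x); rewrite ?mul1r ?mul0r ?add0r ?subrK.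
  over.
by rewrite avgD (@avg_is_zero_mul zero_ord)// avg_cst ?ord_gt0//; ring.
Qed.

(** The two means are proved together by reading the pattern: the first is the
    state where the position was used by the last letter, the second the state
    where it has just been refreshed. A propagating letter read in the second
    state produces a rise with probability [rise_rate]. *)
Lemma rises_moment1 kap :
  (avg (fun x => thinning_from x kap (fun k => (rises (is_zero x) k)%:R)) =
    rise_rate * (rises true kap)%:R) *
  (p * thinning kap (fun k => (rises true k)%:R) +
   (1 - p) * thinning kap (fun k => (rises false k)%:R) =
    rise_rate * (rises false kap)%:R).
Proof.
elim: kap => [|[] kap [IH1 IH2]].
- by rewrite /thinning /= !avg_cst ?ord_gt0// !mulr0 addr0.
- have e (c : bool) : thinning (true :: kap) (fun k => (rises c k)%:R) =
      p * (~~ c)%:R + rise_rate * (rises true kap)%:R.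
    rewrite -IH1 -[X in X + _](@avg_is_zero_mul zero_ord (fun=> (~~ c)%:R))// -avgD.
    apply: eq_avg => x /=; rewrite -[X in X + _](thinning_from_cst x kap) -thinning_fromD.
    congr thinning_from; apply/funext => k; rewrite natrD; congr (_ + _).
    by case: c; case: (is_zero x); rewrite ?mulr0 ?mulr1.
  rewrite !e; split=> /=; last by rewrite natrD mulr1n; rewrite /rise_rate; ring.
  rewrite add0n -IH1; apply: eq_avg => x; congr thinning_from; apply/funext => k.
  by case: (is_zero x).
- split=> /=; rewrite add0n -?IH2.
    by rewrite (avg_is_zero (fun c => thinning kap (fun k => (rises c k)%:R))).
  by rewrite /thinning /= !avg_cst ?ord_gt0.
Qed.

Lemma thinning_rises_step kap (F : nat -> R) :
  (thinning (true :: kap) (fun k => F (rises true k)) =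
    avg (fun x => thinning_from x kap (fun k => F (rises (is_zero x) k)))) *
  (thinning (false :: kap) (fun k => F (rises true k)) =
    thinning kap (fun k => F (rises true k))).
Proof.
split; last by rewrite /thinning /= avg_cst ?ord_gt0.
rewrite /thinning /=; apply: eq_avg => x; apply: eq_thinning_from => k.
by case: (is_zero x).
Qed.

Lemma thinning_rises_le kap :
  thinning kap (fun k => (rises true k)%:R) <= rise_rate * (rises true kap)%:R.
Proof.
have a0 := ltW rise_rate_gt0.
elim: kap => [|[] kap IH]; first by rewrite thinning_nil mulr0.
  by rewrite (thinning_rises_step kap (fun n => n%:R)) (rises_moment1 kap).
rewrite (thinning_rises_step kap (fun n => n%:R)) (le_trans IH)//.
by rewrite ler_wpM2l// ler_nat rises_true_false.
Qed.

(** A rise of [kap] gives a rise of the section with probability [rise_rate],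
    except for the first rise when no propagating letter precedes it. *)
Lemma thinning_rises_ge kap :
  rise_rate * ((rises true kap)%:R - 1) <= thinning kap (fun k => (rises true k)%:R).
Proof.
have a0 := ltW rise_rate_gt0.
apply: (@le_trans _ _ (rise_rate * ((rises false kap)%:R - 1))).
  by rewrite ler_wpM2l// lerB// ler_nat rises_true_false.
elim: kap => [|[] kap IH].
- by rewrite thinning_nil sub0r mulrN1 oppr_le0.
- rewrite (thinning_rises_step kap (fun n => n%:R)) (rises_moment1 kap) /=.
  by rewrite ler_wpM2l// natrD addrC addKr.
- by rewrite (thinning_rises_step kap (fun n => n%:R)).
Qed.

Lemma thinning_from0_rises_le kap z : is_zero z ->
  thinning_from z kap (fun k => (rises true k)%:R) <= rise_rate * (rises true kap)%:R.
Proof.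
move=> z0; have a0 := ltW rise_rate_gt0.
elim: kap => [|[] kap IH] /=; first by rewrite mulr0.
  by rewrite z0 add0n.
rewrite add0n (le_trans (thinning_rises_le kap))//.
by rewrite ler_wpM2l// ler_nat rises_true_false.
Qed.

(** [fact2] is the second factorial moment. In the section, two successive rises of
    [kap] never both survive, since this would need the same position to be zero
    and nonzero; other pairs survive independently. Hence pairs of rises are
    thinned by [rise_rate ^+ 2] at most, with no lower order term. *)
Lemma rises_moment2 kap :
  (avg (fun x => thinning_from x kap (fun k => fact2 (rises (is_zero x) k))) <=
    rise_rate ^+ 2 * fact2 (rises true kap)) *
  (p * thinning kap (fun k => fact2 (rises true k)) +
   (1 - p) * thinning kap (fun k => fact2 (rises false k)) <=
    rise_rate ^+ 2 * fact2 (rises false kap)).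
Proof.
have /andP[p0 p1] := invm_bounds.
elim: kap => [|[] kap [IH1 IH2]].
- by rewrite /thinning /= !avg_cst ?ord_gt0// /fact2 !mulr0 addr0.
- have e (c : bool) : thinning (true :: kap) (fun k => fact2 (rises c k)) =
      avg (fun x => thinning_from x kap (fun k => fact2 (rises (is_zero x) k))) +
      p * ((~~ c)%:R * 2 *
           thinning_from zero_ord kap (fun k => (rises true k)%:R)).
    rewrite -(@avg_is_zero_mul zero_ord (fun x => (~~ c)%:R * 2 *
       thinning_from x kap (fun k => (rises true k)%:R)))// -avgD.
    apply: eq_avg => x /=; rewrite -!thinning_fromZ -thinning_fromD.
    congr thinning_from; apply/funext => k; case: c; case: (is_zero x) => /=;
      rewrite ?add0n ?mul0r ?mulr0 ?addr0// ?mul1r ?mulr0 ?addr0//.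
    by rewrite add1n fact2S.
  split.
    rewrite /= add0n; under eq_avg => x.
      rewrite (eq_thinning_from _ _ (Psi' := fun k => fact2 (rises (is_zero x) k))).
        over.
      by move=> k; case: (is_zero x).
    exact: IH1.
  rewrite !e /= add1n fact2S mul0r mul0r mulr0 addr0 mul1r.
  have := thinning_from0_rises_le kap (z := zero_ord) (eqxx _).
  set u := thinning_from _ _ _; set v := avg _; move=> hu.
  rewrite (_ : p * v + _ = v + 2 * rise_rate * u); last by rewrite /rise_rate; ring.
  rewrite mulrDr lerD// (@le_trans _ _ (2 * rise_rate * (rise_rate * (rises true kap)%:R)))//.
    by rewrite ler_wpM2l// mulr_ge0// ltW// rise_rate_gt0.
  by rewrite le_eqVlt; apply/orP; left; apply/eqP; ring.
- split=> /=; rewrite add0n.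
    by rewrite (avg_is_zero (fun c => thinning kap (fun k => fact2 (rises c k)))).
  by move: IH2; rewrite /thinning /= !avg_cst ?ord_gt0.
Qed.

Lemma thinning_fact2_le kap :
  thinning kap (fun k => fact2 (rises true k)) <=
    rise_rate ^+ 2 * fact2 (rises true kap).
Proof.
elim: kap => [|[] kap IH]; first by rewrite thinning_nil /fact2 mulr0.
  by rewrite (thinning_rises_step kap fact2) (rises_moment2 kap).
rewrite (thinning_rises_step kap fact2) (le_trans IH)//.
apply: ler_wpM2l; first by rewrite exprn_ge0// ltW// rise_rate_gt0.
exact/ler_fact2/rises_true_false.
Qed.

End Thinning.

Definition alternating n := flatten (nseq n [:: true; false]).

Lemma rises_alternating n : rises true (alternating n) = n.-1.
Proof.
case: n => //= n; rewrite add0n.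
by elim: n => //= n IH; rewrite add0n IH.
Qed.

(** Independent fair letters are the section of a strictly alternating pattern at
    a level of degree [2]. The moment bounds of one level thus also apply to the
    initial word of the walk. *)
Lemma thinning_alternating n Psi :
  thinning 2 (alternating n) Psi = avgn n Psi.
Proof.
elim: n Psi => [|n IH] Psi; first by rewrite thinning_nil.
rewrite [LHS]/thinning /=.
rewrite (avg_is_zero (m := 2) _ (fun c => thinning 2 (alternating n) (fun k => Psi (c :: k))))//.
by rewrite !IH avg_bool mulrDr; congr (_ * _ + _ * _); lra.
Qed.

End Blocks.

Lemma prop_funM m (s t : forall i, 'S_(m i)) w :
  prop_fun (fun i => (s i * t i)%g) w = prop_fun t (prop_fun s w).
Proof.
elim: w s t => //= {}m x w IH s t; congr Defs.Cons; case: ifP => x0.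
  exact: (IH (fun i => s i.+1) (fun i => t i.+1)).
by case: w {IH} => //= y w; rewrite permM.
Qed.

Lemma prop_fun1 m (s : forall i, 'S_(m i)) w :
  (forall i, s i = 1%g) -> prop_fun s w = w.
Proof.
elim: w s => //= {}m x w IH s s1; congr Defs.Cons; case: ifP => x0.
  by apply: IH => i; exact: s1.
by case: w {IH} => //= y w; rewrite s1 perm1.
Qed.

(** * Words in the generators, their sections and their codes *)

Section Levels.
Variable M : nat.

(** Only the two degrees [2] and [M] are used; [b i] tells which one stands at
    level [i]. *)
Definition mseq (b : nat -> bool) (i : nat) : nat := if b i then M else 2.

Definition nextb (b : nat -> bool) : nat -> bool := fun i => b i.+1.

Local Notation seed := ('S_2 * 'S_M)%type.

(** One pair of permutations, one for each degree, determines a rooted permutation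
    at every level and also a propagating action. *)
Definition perm_at (b : nat -> bool) (i : nat) (t : seed) : 'S_(mseq b i) :=
  if b i as c return 'S_(if c then M else 2) then t.2 else t.1.

Lemma perm_atM b i s t : perm_at b i (s * t)%g = (perm_at b i s * perm_at b i t)%g.
Proof. by rewrite /perm_at /mseq; case: (b i). Qed.

Lemma perm_at1 b i : perm_at b i 1%g = 1%g.
Proof. by rewrite /perm_at /mseq; case: (b i). Qed.

Section Letters.
Variable Lam : finGroupType.

(** The letters of the words that describe the walk and its sections: rooted
    permutation, propagating action followed by a lamp change, and lamp change
    alone. A propagating action always comes with a lamp change, so that a section
    that meets one also meets a lamp. *)
Inductive token : Type :=
  | Sy of seed
  | Pr of seed & Lam
  | Lp of Lam.

Implicit Types (b : nat -> bool) (W : seq token) (t : seed).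

Definition kind_seed (W : seq token) : seq (bool * seed) :=
  pmap (fun l => match l with
    | Sy t => Some (false, t) | Pr t _ => Some (true, t) | Lp _ => None end) W.

Definition kinds (W : seq token) : seq bool := map fst (kind_seed W).

Definition letter_aut b (l : token) : aut (mseq b) :=
  match l with
  | Sy t => rooted (perm_at b 0 t)
  | Pr t _ => propagating (fun i => perm_at b i t)
  | Lp _ => 1%g
  end.

Definition is_origin (m : nat -> nat) (s : letters m) : bool :=
  `[< forall i, s i = 0 :> nat >].

Definition lamp_of (l : token) : Lam :=
  match l with Sy _ => 1%g | Pr _ a => a | Lp a => a end.

Fixpoint word_aut b W : aut (mseq b) :=
  if W is l :: W' then (letter_aut b l * word_aut b W')%g else 1%g.

(** The lamps of the product of the letters of [W] in the wreath product. A letter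
    changes the lamp of [s] only if the letters before it bring [s] to the origin;
    propagating actions fix the origin, so it does not matter on which side of
    them the lamp is changed. *)
Fixpoint lamp_config b W (s : letters (mseq b)) : Lam :=
  if W is l :: W' then
    ((if is_origin s then lamp_of l else 1) * lamp_config W' (letters_act s (letter_aut b l)))%g
  else 1%g.

(** The word read by a particle at [x] on the first level. At [0] a propagating
    action acts below as a propagating action with the same seed, elsewhere as the
    rooted permutation of the next level given by that seed. Rooted letters only
    move the particle, and a lamp change is seen at [0] only. The seed of a letter
    is thus used to move particles on exactly one level, which makes the seeds of
    the section fresh. *)
Fixpoint sec b (x : 'I_(mseq b 0)) W : seq token :=
  match W with
  | [::] => [::]
  | Sy t :: W' => sec (perm_at b 0 t x) W'
  | Pr t a :: W' => (if is_zero x then Pr t a else Sy t) :: sec x W'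
  | Lp a :: W' => if is_zero x then Lp a :: sec x W' else sec x W'
  end.

Definition tail b (s : letters (mseq b)) : letters (mseq (nextb b)) :=
  fun i => s i.+1.

Lemma is_origin_tail b (s : letters (mseq b)) : is_origin s = is_zero (s 0) && is_origin (tail s).
Proof.
apply/asboolP/andP => [s0|[/eqP s0 /asboolP s1] [|i]//]; last exact: s1.
by split; [apply/eqP; exact: s0|apply/asboolP => i; exact: s0].
Qed.

Lemma rooted_head b (s : letters (mseq b)) u :
  letters_act s (rooted u) 0 = u (s 0).
Proof. by []. Qed.

Lemma rooted_tail b (s : letters (mseq b)) u :
  tail (letters_act s (rooted u)) = tail s.
Proof.
apply: functional_extensionality_dep => i.
exact: (@letter_at_trunc (mseq (nextb b)) (tail s) i.+1 i).
Qed.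

Lemma prop_head b (s : letters (mseq b)) u :
  letters_act s (propagating u) 0 = s 0.
Proof. by []. Qed.

Lemma prop_tail b (s : letters (mseq b)) t :
  tail (letters_act s (propagating (fun i => perm_at b i t))) =
  letters_act (tail s) (if is_zero (s 0) then propagating (fun i => perm_at (nextb b) i t)
    else rooted (perm_at (nextb b) 0 t)).
Proof.
apply: functional_extensionality_dep => i.
by rewrite /tail /letters_act /= /is_zero; case: ifP.
Qed.

(** Propagating actions fix the origin, and so do their inverses. *)
Lemma is_origin_prop b (s : letters (mseq b)) t :
  is_origin (letters_act s (propagating (fun i => perm_at b i t))) = is_origin s.
Proof.
have fix0 (s' : letters (mseq b)) t' : is_origin s' ->
    letters_act s' (propagating (fun i => perm_at b i t')) = s'.
  move=> /asboolP s0; apply: functional_extensionality_dep => i.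
  rewrite /letters_act -[aut_fun _]/(prop_fun _) prop_fun_origin//.
  exact: letter_at_trunc.
apply/idP/idP => [h|/fix0 ->//].
have : is_origin (letters_act (letters_act s (propagating (perm_at b ^~ t)))
   (propagating (perm_at b ^~ t))^-1%g).
  have -> : ((propagating (perm_at b ^~ t))^-1 = propagating (perm_at b ^~ t^-1))%g.
    rewrite propagatingV; congr propagating.
    apply: functional_extensionality_dep => i.
    by apply: (mulIg (perm_at b i t)); rewrite mulVg -perm_atM mulVg perm_at1.
  by rewrite fix0.
by rewrite -letters_actM mulgV letters_act1.
Qed.

Lemma lamp_config_sec b W s : lamp_config W s = lamp_config (b := nextb b) (sec (s 0) W) (tail s).
Proof.
elim: W s => //= -[t|t a|a] W IH s.
- by rewrite /= IH rooted_tail if_same mul1g.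
- rewrite [in LHS]/= IH prop_tail prop_head is_origin_tail.
  by case: (is_zero (s 0)) => //=; rewrite if_same.
- rewrite /= letters_act1 IH is_origin_tail.
  by case: (is_zero (s 0)) => //=; rewrite ?mul1g// letters_act1.
Qed.

Fixpoint sprod W : seed :=
  match W with
  | [::] => 1%g
  | Sy t :: W' => (t * sprod W')%g
  | _ :: W' => sprod W'
  end.

Fixpoint hprod W : seed :=
  match W with
  | [::] => 1%g
  | Pr t _ :: W' => (t * hprod W')%g
  | _ :: W' => hprod W'
  end.

Lemma word_aut_sec b W x w :
  word_aut b W (Defs.Cons x w) =
  Defs.Cons (perm_at b 0 (sprod W) x) (word_aut (nextb b) (sec x W) w).
Proof.
elim: W x w => [|[t|t a|a] W IH] x w /=.
- by rewrite perm_at1 perm1.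
- by rewrite IH perm_atM permM.
- by rewrite /= IH /is_zero; case: ifP.
- by rewrite IH; case: ifP.
Qed.

(** The total change of the lamp at the site whose first letter is [x] and whose
    other letters are zero, when propagating actions are ignored. *)
Fixpoint lamp_level1 b W (x : 'I_(mseq b 0)) : Lam :=
  match W with
  | [::] => 1%g
  | Sy t :: W' => lamp_level1 W' (perm_at b 0 t x)
  | l :: W' => ((if is_zero x then lamp_of l else 1) * lamp_level1 W' x)%g
  end.

Lemma rootedM b s t :
  rooted (perm_at b 0 (s * t)%g) = (rooted (perm_at b 0 s) * rooted (perm_at b 0 t))%g.
Proof. by apply: aut_ext => -[|x w] //=; rewrite perm_atM permM. Qed.

Lemma rooted1 b : rooted (perm_at b 0 1%g) = 1%g.
Proof. by apply: aut_ext => -[|x w] //=; rewrite perm_at1 perm1. Qed.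

Lemma propM b s t :
  propagating (fun i => perm_at b i (s * t)%g) =
  (propagating (fun i => perm_at b i s) * propagating (fun i => perm_at b i t))%g.
Proof.
apply: aut_ext => w; rewrite [RHS]/= -prop_funM /=; congr prop_fun.
by apply: functional_extensionality_dep => i; exact: perm_atM.
Qed.

Lemma prop1 b : propagating (fun i => perm_at b i 1%g) = 1%g.
Proof. by apply: aut_ext => w; apply: prop_fun1 => i; exact: perm_at1. Qed.

Section Leaf.

Lemma leaf_sym b W : rises false (kinds W) = 0 ->
  [/\ hprod W = 1%g, word_aut b W = rooted (perm_at b 0 (sprod W)) &
    forall s, lamp_config W s = if is_origin (tail s) then @lamp_level1 b W (s 0) else 1%g].
Proof.
elim: W => [|[t|t a|a] W IH] //=.
- by move=> _; split; rewrite ?rooted1// => s; case: ifP.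
- rewrite /kinds /= -/(kinds W) add0n => /IH[-> -> E]; split=> //.
    by rewrite rootedM.
  by move=> s; rewrite if_same mul1g E rooted_tail rooted_head.
- move=> /IH[-> -> E]; split=> //; first by rewrite mul1g.
  move=> s; rewrite letters_act1 E is_origin_tail andbC.
  by case: (is_origin _); rewrite /= ?mul1g.
Qed.

(** A word without rise is a product of propagating actions followed by rooted
    permutations, lamp changes interspersed. The rooted part only changes lamps of
    sites that are zero beyond the first letter. *)
Lemma leafP b W : rises true (kinds W) = 0 ->
  word_aut b W =
    (propagating (fun i => perm_at b i (hprod W)) * rooted (perm_at b 0 (sprod W)))%g /\
  forall s, lamp_config W s =
    if is_origin (tail (letters_act s (propagating (fun i => perm_at b i (hprod W)))))
    then @lamp_level1 b W (s 0) else 1%g.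
Proof.
elim: W => [|[t|t a|a] W IH] //=.
- by rewrite prop1 rooted1 mulg1; split=> // s; case: ifP.
- move=> r0; have [|/= h1 w1 E] := @leaf_sym b (Sy t :: W); first by [].
  by rewrite h1 prop1 mul1g w1; split=> // s; rewrite letters_act1 E.
- rewrite /kinds /= -/(kinds W) add0n => /IH[-> E]; split.
    by rewrite propM mulgA.
  move=> s; rewrite E -letters_actM -propM.
  rewrite -(is_origin_prop s (t * hprod W)%g) is_origin_tail prop_head prop_head.
  by rewrite andbC; case: (is_origin _); rewrite /= ?mul1g.
- move=> /IH[-> E]; split; first by rewrite mul1g.
  move=> s; rewrite letters_act1 E.
  rewrite -(is_origin_prop s (hprod W)) is_origin_tail prop_head.
  by rewrite andbC; case: (is_origin _); rewrite /= ?mul1g.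
Qed.

End Leaf.

Fixpoint seed_sec b (x : 'I_(mseq b 0)) (w : seq (bool * seed)) :
    seq (bool * seed) :=
  match w with
  | [::] => [::]
  | (true, t) :: w' => (is_zero x, t) :: seed_sec x w'
  | (false, t) :: w' => seed_sec (perm_at b 0 t x) w'
  end.

Lemma kind_seed_section b x W : kind_seed (@sec b x W) = seed_sec x (kind_seed W).
Proof.
elim: W x => [|[t|t a|a] W IH] x //=; first by case: (is_zero x); rewrite /= IH.
by case: (is_zero x); rewrite /= IH.
Qed.

Lemma size_seed_sec b x w : (size (@seed_sec b x w) <= size w)%N.
Proof.
elim: w x => [|[[] t] w IH] x //=; first by rewrite ltnS.
by rewrite (leq_trans (IH _)).
Qed.

(** A rise needs a rooted letter, which the section forgets. So the recursion on
    sections stops within as many levels as there are letters. *)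
Lemma size_seed_sec_lt b x w :
  (0 < rises true (map fst w))%N -> (size (@seed_sec b x w) < size w)%N.
Proof.
elim: w x => [|[[] t] w IH] x //=; first by rewrite ltnS; exact: IH.
by rewrite ltnS size_seed_sec.
Qed.

(** A word with a rise contributes its rooted permutation, a word without rise its
    three data from [leafP]. *)
Definition symbol : finType :=
  (seed + seed * seed * {ffun 'I_M -> Lam})%type.

Definition leaf_lamps b W : {ffun 'I_M -> Lam} :=
  [ffun i => if insub (val i) is Some x then @lamp_level1 b W x else 1%g].

(** Preorder traversal of the tree of sections, cut at the words without rise; [f]
    bounds the depth. *)
Fixpoint code (f : nat) b W : seq symbol :=
  if f is f'.+1 then
    if rises true (kinds W) == 0%N then [:: inr (hprod W, sprod W, leaf_lamps b W)]
    else inl (sprod W) ::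
      flatten [seq code f' (nextb b) (sec x W) | x <- index_enum 'I_(mseq b 0)]
  else [:: inr (hprod W, sprod W, leaf_lamps b W)].

Definition same_value b W W' :=
  word_aut b W =1 word_aut b W' /\ @lamp_config b W =1 lamp_config W'.

Lemma leaf_eq b W W' : (1 < M)%N ->
  rises true (kinds W) = 0 -> rises true (kinds W') = 0 ->
  hprod W = hprod W' -> sprod W = sprod W' ->
  leaf_lamps b W = leaf_lamps b W' -> same_value b W W'.
Proof.
move=> M1 /(leafP b)[w1 l1] /(leafP b)[w2 l2] h s /ffunP ll.
split; first by rewrite w1 w2 h s.
move=> x; rewrite l1 l2 h; case: ifP => // _.
have xM : (x 0 < M)%N.
  by apply: leq_trans (ltn_ord _) _; rewrite /mseq; case: (b 0).
have := ll (Ordinal xM); rewrite !ffunE /=.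
by rewrite insubT //= => ltx; rewrite (_ : Sub _ _ = x 0) //; exact: val_inj.
Qed.

(** The code is prefix free because the first symbol tells whether sections
    follow. *)
Lemma code_inj f b W W' r r' : (1 < M)%N ->
  (size (kind_seed W) <= f)%N -> (size (kind_seed W') <= f)%N ->
  code f b W ++ r = code f b W' ++ r' -> r = r' /\ same_value b W W'.
Proof.
move=> M1; elim: f b W W' r r' => [|f IH] b W W' r r' /=.
  have leaf V : (size (kind_seed V) <= 0)%N -> rises true (kinds V) = 0.
    by rewrite /kinds; case: (kind_seed V).
  by move=> /leaf W0 /leaf W0' [h s l ->]; split=> //; exact: leaf_eq.
move=> Wf Wf'; case: eqP => W0; case: eqP => W0' //=.
  by move=> [h s l ->]; split=> //; exact: leaf_eq.
move=> [s]; have sz V x : (size (kind_seed V) <= f.+1)%N ->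
    rises true (kinds V) <> 0 -> (size (kind_seed (@sec b x V)) <= f)%N.
  move=> Vf /eqP; rewrite -lt0n => V0; rewrite kind_seed_section -ltnS.
  exact: leq_trans (size_seed_sec_lt _ V0) Vf.
suff H : forall xs : seq 'I_(mseq b 0),
    flatten [seq code f (nextb b) (sec x W) | x <- xs] ++ r =
    flatten [seq code f (nextb b) (sec x W') | x <- xs] ++ r' ->
    r = r' /\ forall x, x \in xs -> same_value (nextb b) (sec x W) (sec x W').
  move=> /H[-> all_same]; split=> //; split.
    case=> [|x w]; first by rewrite !aut_root.
    rewrite !word_aut_sec s; congr Defs.Cons.
    by have [-> _] := all_same x (mem_index_enum _).
  move=> y; rewrite [LHS]lamp_config_sec [RHS]lamp_config_sec.
  by have [_ ->] := all_same (y 0) (mem_index_enum _).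
elim=> [|x xs IHxs] /=; first by move=> ->.
rewrite -!catA => /IH[||/IHxs[-> H] Hx]; [exact: sz|exact: sz|].
by split=> // y; rewrite inE => /orP[/eqP ->|/H].
Qed.

Fixpoint code_size (f : nat) b (w : seq (bool * seed)) : nat :=
  if f is f'.+1 then
    if rises true (map fst w) == 0%N then 1
    else (1 + \sum_(x < mseq b 0) code_size f' (nextb b) (seed_sec x w))%N
  else 1.

Lemma size_code f b W : size (code f b W) = code_size f b (kind_seed W).
Proof.
elim: f b W => //= f IH b W; case: ifP => //= _.
rewrite size_flatten sumnE /shape !big_map; congr S.
by apply: eq_bigr => x _; rewrite IH kind_seed_section.
Qed.

End Letters.
End Levels.

(** * Visited vertices and the law of the lamps *)

HB.instance Definition _ (m : nat -> nat) := gen_eqMixin (Defs.word m).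

Section Visits.
Variables (R : realType) (M : nat) (Lam : finGroupType).
Hypothesis M_gt1 : (1 < M)%N.
Local Notation seed := ('S_2 * 'S_M)%type.
Local Notation token := (@token M Lam).
Implicit Types (b : nat -> bool) (W : seq token) (t : seed).

Fixpoint zero_word (m : nat -> nat) (v : Defs.word m) : bool :=
  if v is Defs.Cons x v' then (x == 0 :> nat) && zero_word v' else true.

(** Some lamp change is met while [v] stands at the vertex [0 .. 0] of its level. *)
Fixpoint visited b W (v : Defs.word (mseq M b)) : bool :=
  match W with
  | [::] => false
  | Sy t :: W' => visited W' (letter_aut b (Sy Lam t) v)
  | l :: W' => zero_word v || visited W' (letter_aut b l v)
  end.

Lemma visited_sec b W x v : @visited b W (Defs.Cons x v) = visited (sec x W) v.
Proof.
elim: W x v => [|[t|t a|a] W IH] x v //=.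
- by rewrite IH /is_zero; case: ifP.
- by rewrite IH /is_zero; case: ifP.
Qed.

Fixpoint level (k : nat) b : seq (Defs.word (mseq M b)) :=
  if k is k'.+1 then
    flatten [seq [seq Defs.Cons x v | v <- level k' (nextb b)]
            | x <- index_enum 'I_(mseq M b 0)]
  else [:: Defs.Root].

Definition num_visited k b W : nat := count (@visited b W) (level k b).

Lemma num_visitedS k b W :
  num_visited k.+1 b W = (\sum_(x < mseq M b 0) num_visited k (nextb b) (sec x W))%N.
Proof.
rewrite /num_visited /= count_flatten sumnE !big_map; apply: eq_bigr => x _.
by rewrite count_map; apply: eq_count => v /=; exact: visited_sec.
Qed.

Lemma mseq_gt1 b i : (1 < mseq M b i)%N.
Proof. by rewrite /mseq; case: (b i). Qed.

Lemma mem_level k b v : (v \in level k b) = (depth v == k).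
Proof.
elim: k b v => [|k IH] b v.
  by rewrite inE; apply/eqP/eqP => [->//|]; exact: depth0.
apply/flatten_mapP/eqP => [[x _ /mapP[w]]|].
  by rewrite IH => /eqP wk -> /=; rewrite wk.
case: v => //= x w [wk]; exists x; rewrite ?mem_index_enum//.
by apply: map_f; rewrite IH wk.
Qed.

Lemma uniq_level k b : uniq (level k b).
Proof.
elim: k b => //= k IH b; apply: allpairs_uniq.
- exact: index_enum_uniq.
- exact: IH.
by move=> [x v] [y w] _ _ /= [-> ->].
Qed.

(** Automorphisms permute each level. *)
Lemma count_level_aut k b (g : aut (mseq M b)) (P : pred (Defs.word (mseq M b))) :
  count (fun v => P (g v)) (level k b) = count P (level k b).
Proof.
rewrite -(count_map g); apply/seq.permP.
apply: uniq_perm; rewrite ?uniq_level//.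
  by rewrite map_inj_uniq ?uniq_level//; exact: bij_inj (aut_bij g).
move=> v; rewrite mem_level; apply/mapP/eqP => [[w]|vk].
  by rewrite mem_level => /eqP wk ->; rewrite aut_depth.
exists (aut_inv_fun g v); last by rewrite aut_inv_funVK.
by rewrite mem_level -(aut_depth g) aut_inv_funVK vk.
Qed.

Definition letters0 b : letters (mseq M b) :=
  fun i => Ordinal (ltnW (mseq_gt1 b i)).

Lemma zero_word_inj m (v w : Defs.word m) :
  zero_word v -> zero_word w -> depth v = depth w -> v = w.
Proof.
elim: v w => [m1|m1 x v IH] [|y w] //= /andP[/eqP x0 v0] /andP[/eqP y0 w0] [vw].
by rewrite (IH w)//; congr Defs.Cons; apply: val_inj; rewrite /= x0.
Qed.

Lemma is_origin_zero_word m k (s : letters m) : is_origin s -> zero_word (trunc k s).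
Proof.
move=> /asboolP; elim: k m s => //= k IH m s s0; rewrite s0 eqxx /=.
exact: (IH (Defs.shift m) (fun i => s i.+1) (fun i => s0 i.+1)).
Qed.

Lemma is_origin_letters0 b : is_origin (letters0 b).
Proof. by apply/asboolP. Qed.

Lemma zero_word_prop m (u : forall i, 'S_(m i)) v : zero_word (prop_fun u v) = zero_word v.
Proof. by elim: v u => //= {}m x v IH u; case: ifP => //= _; exact: IH. Qed.

(** The lamp at [s] changes only if [s], and then also its prefix, is brought to
    zero. *)
Lemma lamp_config_visited k b W s : lamp_config W s <> 1%g -> @visited b W (trunc k s).
Proof.
elim: W s => //= l W IH s.
have step : lamp_config W (letters_act s (letter_aut b l)) <> 1%g ->
    @visited b W (letter_aut b l (trunc k s)) by move=> /IH; rewrite truncA.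
case: ifP => [/(is_origin_zero_word k) s0|_]; last first.
  by rewrite mul1g => /step; case: l {step} => //= *; apply/orP; right.
by case: l step => [t|t a|a] /=; rewrite ?s0// mul1g.
Qed.

Definition zero_vertex k b : Defs.word (mseq M b) := trunc k (letters0 b).

Lemma count_zero k b W :
  count (fun v => zero_word v || @visited b W v) (level k b) =
  (num_visited k b W + ~~ @visited b W (zero_vertex k b))%N.
Proof.
have zE v : v \in level k b -> zero_word v = (v == zero_vertex k b).
  rewrite mem_level => /eqP vk; apply/idP/eqP => [v0|->].
    by apply: zero_word_inj => //; rewrite ?depth_trunc// is_origin_zero_word// is_origin_letters0.
  by rewrite is_origin_zero_word// is_origin_letters0.
have c1 (c : bool) : count (fun v => (v == zero_vertex k b) && c) (level k b) = c.
  case: c; last by rewrite (eq_count (a2 := pred0)) ?count_pred0// => v; rewrite andbF.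
  rewrite (eq_count (a2 := pred1 (zero_vertex k b))) => [|v]; last by rewrite andbT.
  by rewrite count_uniq_mem ?uniq_level// mem_level depth_trunc eqxx.
have := count_predUI (zero_word (m := _)) (@visited b W) (level k b).
have -> : count (zero_word (m := mseq M b)) (level k b) = 1%N.
  by apply: etrans (c1 true); apply: eq_in_count => v /zE ->; rewrite andbT.
have -> : count (predI (zero_word (m := _)) (@visited b W)) (level k b) =
    @visited b W (zero_vertex k b).
  rewrite -(c1 (visited W _)); apply: eq_in_count => v /zE /= ->.
  by case: eqP => // ->.
rewrite (eq_count (a2 := fun v => zero_word v || @visited b W v)); last by [].
by rewrite /num_visited; case: (visited W _) => /=; lia.
Qed.

(** A further letter in front permutes the visited vertices of a level and, if it
    changes a lamp, adds the vertex [0 .. 0]. *)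
Lemma num_visited_cons k b l W :
  num_visited k b (l :: W) =
  (num_visited k b W + (if l is Sy _ then 0 else ~~ @visited b W (zero_vertex k b)))%N.
Proof.
rewrite /num_visited; case: l => [t|t a|a] /=.
- by rewrite addn0; exact: (count_level_aut k (rooted (perm_at b 0 t)) (@visited b W)).
- apply: etrans (count_zero k b W).
  apply: etrans (count_level_aut k (propagating (fun i => perm_at b i t)) _).
  by apply: eq_count => v /=; rewrite zero_word_prop.
- exact: count_zero.
Qed.

Fixpoint avg_lamps W (Phi : seq token -> R) : R :=
  match W with
  | [::] => Phi [::]
  | Sy t :: W' => avg_lamps W' (fun V => Phi (Sy Lam t :: V))
  | Pr t _ :: W' => avg (fun a => avg_lamps W' (fun V => Phi (Pr t a :: V)))
  | Lp _ :: W' => avg (fun a => avg_lamps W' (fun V => Phi (Lp M a :: V)))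
  end.

Lemma ler_avg_lamps W Phi Psi :
  (forall V, (forall b, @visited b V =1 visited W) -> Phi V <= Psi V) ->
  avg_lamps W Phi <= avg_lamps W Psi.
Proof.
elim: W Phi Psi => [|l W IH] Phi Psi PP /=; first exact: PP.
case: l PP => [t|t a|a] PP; last 2 first.
- apply: ler_avg => a'; apply: IH => V VW; apply: PP => b v /=.
  by rewrite VW.
- apply: ler_avg => a'; apply: IH => V VW; apply: PP => b v /=.
  by rewrite VW.
- by apply: IH => V VW; apply: PP => b v /=; rewrite VW.
Qed.

Lemma avg_lampsZ W c Phi : avg_lamps W (fun V => c * Phi V) = c * avg_lamps W Phi.
Proof.
elim: W Phi => [|[t|t a|a] W IH] Phi //=; rewrite -avgZ.
- by apply: eq_avg => a'; exact: IH.
- by apply: eq_avg => a'; exact: IH.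
Qed.

Definition lamps_are b (F : letters (mseq M b) -> Lam) W : R := `[< lamp_config W =1 F >]%:R.

Lemma ler_indic (P Q : Prop) : (P -> Q) -> (`[< P >]%:R : R) <= `[< Q >]%:R.
Proof. by move=> PQ; rewrite ler_nat; case: asboolP => // /PQ/asboolT ->. Qed.

Hypothesis Lam_gt1 : (1 < #|Lam|)%N.

(** By induction on [W], read from the front. If the first lamp change makes
    [0 .. 0] newly visited, no other letter changes the lamp of the origin, so the
    value of this first lamp is forced, which costs a factor of at least [2].
    Otherwise each value of the first lamp is covered by the induction
    hypothesis. *)
Lemma avg_lamps_le k b W F : avg_lamps W (lamps_are (b := b) F) <= 2 ^- num_visited k b W.
Proof.
elim: W b F => [|l W IH] b F.
  by rewrite /num_visited /= count_pred0 expr0 invr1 lern1 leq_b1.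
have Lam0 : (0 < #|Lam|)%N by exact: ltnW.
pose g := letter_aut b l.
(* what the letters after [l] must do to the lamps, once the lamp of [l] is [a] *)
pose F' a (s : letters (mseq M b)) : Lam :=
  ((if is_origin (letters_act s g^-1) then a else 1)^-1 * F (letters_act s g^-1))%g.
have shiftF a V : (forall s, ((if is_origin s then a else 1) *
    lamp_config V (letters_act s g))%g = F s) -> lamp_config V =1 F' a.
  move=> E s; rewrite /F' -E mulKg -letters_actM mulVg letters_act1 //.
have -> : num_visited k b (l :: W) = (num_visited k b W +
  (if l is Sy _ then 0 else ~~ @visited b W (zero_vertex k b)))%N by exact: num_visited_cons.
have key a : avg_lamps W (fun V => `[< forall s, ((if is_origin s then a else 1) *
     lamp_config V (letters_act s g))%g = F s >]%:R) <= 2 ^- num_visited k b W.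
  apply: le_trans (IH b (F' a)); apply: ler_avg_lamps => V _.
  by apply: ler_indic; exact: shiftF.
have g0 : (forall t, l <> Sy Lam t) -> g (zero_vertex k b) = zero_vertex k b.
  rewrite /g; case: {key shiftF F' g} l => [t /(_ t)//|t a _|//].
  apply: zero_word_inj; rewrite ?aut_depth//= ?zero_word_prop//;
    exact/is_origin_zero_word/is_origin_letters0.
have main : (forall t, l <> Sy Lam t) ->
    avg (fun a => avg_lamps W (fun V => `[< forall s, ((if is_origin s then a else 1) *
     lamp_config V (letters_act s g))%g = F s >]%:R)) <=
    2 ^- (num_visited k b W + ~~ @visited b W (zero_vertex k b)).
  move=> lN; case: (boolP (visited _ _)) => [_|notvis].
    by rewrite addn0 -[leRHS](avg_cst _ Lam0); apply: ler_avg => a; exact: key.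
  rewrite addn1 exprS invfM.
  apply: (@le_trans _ _ (avg (fun a => (a == F (letters0 b))%:R * 2 ^- num_visited k b W))).
    apply: ler_avg => a; case: eqP => aF.
      by rewrite mul1r; exact: key.
    rewrite mul0r -(mul0r (avg_lamps W (fun=> 0))) -avg_lampsZ.
    apply: ler_avg_lamps => V VW; rewrite mul0r lern0 eqb0.
    apply/asboolPn => /(_ (letters0 b)); rewrite is_origin_letters0.
    have -> : lamp_config V (letters_act (letters0 b) g) = 1%g.
      apply: contrapT => /(@lamp_config_visited k); rewrite truncA VW.
      by rewrite -/(zero_vertex k b) (g0 lN); exact/negP.
    by rewrite mulg1.
  under eq_avg do rewrite mulrC.
  rewrite avgZ mulrC ler_wpM2r ?invr_ge0 ?exprn_ge0//.
  rewrite /avg (bigD1 (F (letters0 b)))//= eqxx big1 ?addr0 => [|a /negPf ->//].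
  by rewrite mulr1 lef_pV2 ?posrE ?ltr0n ?ler_nat.
case: l @g {shiftF F' g0} key main => [t|t a|a] g key main /=.
- by rewrite addn0; exact: (key 1%g).
- exact: main.
- exact: main.
Qed.

End Visits.

(** * Expected code length and expected number of visited vertices *)

Section Means.
Variables (R : realType) (M : nat).
Hypothesis M_gt1 : (1 < M)%N.
Local Notation seed := ('S_2 * 'S_M)%type.
Implicit Types (b : nat -> bool) (kap : seq bool) (w : seq (bool * seed)).

(** Replacing [u] by [tperm x y * u] shows that the average does not depend on
    [x]. *)
Lemma avg_perm n (g : 'I_n -> R) (x : 'I_n) :
  avg (fun u : 'S_n => g (u x)) = avg g.
Proof.
have n0 : (0 < #|'I_n|)%N by apply/card_gt0P; exists x.
have S0 : (0 < #|'S_n|)%N by apply/card_gt0P; exists 1%g.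
have e (y : 'I_n) : avg (fun u : 'S_n => g (u x)) = avg (fun u : 'S_n => g (u y)).
  rewrite -(@avg_bij _ _ _ (fun u : 'S_n => (tperm x y * u)%g)) /=.
    by apply: eq_avg => u; rewrite permM tpermL.
  by exists (mulg (tperm x y)^-1) => u; rewrite ?mulKg ?mulKVg.
rewrite -[LHS](avg_cst _ n0); under eq_avg => y do rewrite (e y).
rewrite exchange_avg -[RHS](avg_cst _ S0); apply: eq_avg => u.
by apply: avg_bij; exists (perm_inv u)%g => y; rewrite ?permK ?permKV.
Qed.

Lemma avg_perm_at b i (g : 'I_(mseq M b i) -> R) x :
  avg (fun t : seed => g (perm_at b i t x)) = avg g.
Proof.
have c n : (0 < #|'S_n|)%N by apply/card_gt0P; exists 1%g.
transitivity (avg (fun s : 'S_2 => avg (fun u : 'S_M => g (perm_at b i (s, u) x)))).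
  exact: (avg_pair (fun t : 'S_2 * 'S_M => g (perm_at b i t x))).
rewrite /perm_at /mseq in g x *; case: (b i) g x => g x /=.
  by rewrite avg_cst ?c// avg_perm.
by under eq_avg do rewrite avg_cst ?c//; rewrite avg_perm.
Qed.

Fixpoint avg_seeds kap (Phi : seq (bool * seed) -> R) : R :=
  if kap is c :: kap' then
    avg (fun t : seed => avg_seeds kap' (fun w => Phi ((c, t) :: w)))
  else Phi [::].

Lemma ler_avg_seeds kap Phi Psi :
  (forall w, map fst w = kap -> Phi w <= Psi w) ->
  avg_seeds kap Phi <= avg_seeds kap Psi.
Proof.
elim: kap Phi Psi => [|c kap IH] Phi Psi PP /=; first exact: PP.
by apply: ler_avg => t; apply: IH => w wk; apply: PP; rewrite /= wk.
Qed.

Lemma seed_gt0 : (0 < #|{: seed}|)%N.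
Proof. by apply/card_gt0P; exists 1%g. Qed.

Lemma avg_seeds_fun kap (F : seq bool -> R) :
  avg_seeds kap (fun w => F (map fst w)) = F kap.
Proof.
elim: kap F => //= c kap IH F.
under eq_avg => t do rewrite (IH (fun k => F (c :: k))).
by rewrite avg_cst ?seed_gt0.
Qed.

Lemma avg_seedsD kap F G :
  avg_seeds kap (fun w => F w + G w) = avg_seeds kap F + avg_seeds kap G.
Proof.
by elim: kap F G => //= c kap IH F G; rewrite -avgD; apply: eq_avg => t; exact: IH.
Qed.

Lemma avg_seeds_sum kap (I : Type) (r : seq I) (F : I -> seq (bool * seed) -> R) :
  avg_seeds kap (fun w => \sum_(i <- r) F i w) = \sum_(i <- r) avg_seeds kap (F i).
Proof.
elim: kap F => //= c kap IH F; rewrite -avg_sum; apply: eq_avg => t.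
exact: (IH (fun i w => F i ((c, t) :: w))).
Qed.

(** The rooted letters use their seeds to refresh the position, the other letters
    keep theirs: so the section is a word of the thinned pattern with independent
    uniform seeds again. *)
Lemma avg_seeds_sec_from b x kap Phi :
  avg_seeds kap (fun w => Phi (@seed_sec M b x w)) =
  thinning_from x kap (fun k => avg_seeds k Phi).
Proof.
elim: kap x Phi => //= -[] kap IH x Phi.
  rewrite /= thinning_from_avg; apply: eq_avg => t.
  exact: (IH x (fun w => Phi ((is_zero x, t) :: w))).
under eq_avg => t do rewrite IH.
exact: (avg_perm_at (fun y => thinning_from y kap (fun k => avg_seeds k Phi))).
Qed.

Lemma avg_seeds_sec b kap Phi :
  \sum_(x < mseq M b 0) avg_seeds kap (fun w => Phi (@seed_sec M b x w)) =
  (mseq M b 0)%:R * thinning (mseq M b 0) kap (fun k => avg_seeds k Phi).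
Proof.
rewrite /thinning /avg mulrA card_ord mulfV ?mul1r; last first.
  by rewrite pnatr_eq0 -lt0n ltnW// mseq_gt1.
by apply: eq_bigr => x _; exact: avg_seeds_sec_from.
Qed.

Definition rate b i : R := rise_rate R (mseq M b i).
(** The number of vertices of level [k]. *)
Definition width k b : R := \prod_(i < k) (mseq M b i)%:R.
(** The factor by which the mean number of rises at a vertex decreases from level
    [0] to level [k]. *)
Definition decay k b : R := \prod_(i < k) rate b i.

Lemma widthS k b : width k.+1 b = (mseq M b 0)%:R * width k (nextb b).
Proof. by rewrite /width big_ord_recl. Qed.

Lemma decayS k b : decay k.+1 b = rate b 0 * decay k (nextb b).
Proof. by rewrite /decay big_ord_recl. Qed.

Lemma decay_gt0 k b : 0 < decay k b.
Proof. by apply: prodr_gt0 => i _; apply: rise_rate_gt0; exact: mseq_gt1. Qed.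

Lemma width_ge1 k b : 1 <= width k b.
Proof.
elim: k b => [|k IH] b; first by rewrite /width big_ord0.
rewrite widthS -[leLHS]mulr1 ler_pM// ler1n; exact: ltnW (mseq_gt1 M_gt1 b 0).
Qed.

(** A word with [K > 0] rises costs one symbol and [m] sections with on average at
    most [rise_rate R m * K] rises each. Since [m * rise_rate R m = 1 - 1 / m],
    the bound propagates as soon as the slope is at least [m ^+ 2]. *)
Lemma mean_code_linear f b kap :
  avg_seeds kap (fun w => (code_size f b w)%:R) <=
  1 + M%:R ^+ 2 * (rises true kap)%:R.
Proof.
have m1 := mseq_gt1 M_gt1.
have base k : 1 <= 1 + M%:R ^+ 2 * (rises true k)%:R :> R.
  by rewrite lerDl mulr_ge0// exprn_ge0.
elim: f b kap => [|f IH] b kap /=; first by rewrite (avg_seeds_fun kap (fun=> 1)).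
have [K0|K0] := posnP (rises true kap).
  rewrite K0 mulr0 addr0 -[leRHS](avg_seeds_fun kap (fun=> 1)).
  by apply: ler_avg_seeds => w ->; rewrite K0.
apply: (@le_trans _ _ (avg_seeds kap (fun w => 1 +
    \sum_(x < mseq M b 0) (code_size f (nextb b) (seed_sec x w))%:R))).
  by apply: ler_avg_seeds => w ->; rewrite gtn_eqF// natrD natr_sum.
rewrite avg_seedsD (avg_seeds_fun kap (fun=> 1)) lerD2l avg_seeds_sum.
rewrite (avg_seeds_sec b kap (fun w => (code_size f (nextb b) w)%:R)).
have mM : (mseq M b 0 <= M)%N by rewrite /mseq; case: (b 0).
set m := mseq M b 0 in mM *; have m0 : 0 < m%:R :> R by rewrite ltr0n ltnW// m1.
apply: (@le_trans _ _ (m%:R * (1 + M%:R ^+ 2 * (rise_rate R m * (rises true kap)%:R)))).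
  rewrite ler_pM2l//; apply: (le_trans (ler_thinning _ _ (IH (nextb b)))).
  rewrite thinningD thinningZ thinning_cst ?m1// lerD2l ler_wpM2l ?exprn_ge0//.
  by apply: thinning_rises_le; exact: m1.
have -> : m%:R * (1 + M%:R ^+ 2 * (rise_rate R m * (rises true kap)%:R)) =
    M%:R ^+ 2 * (rises true kap)%:R + (m%:R - M%:R ^+ 2 * (rises true kap)%:R / m%:R).
  by rewrite /rise_rate; field; rewrite gt_eqF.
rewrite gerDl subr_le0 ler_pdivlMr// -expr2 -[leLHS]mulr1.
by rewrite ler_pM ?exprn_ge0// ?ler1n// ler_pXn2r ?nnegrE ?ler_nat.
Qed.

(** There are fewer than [width k b] vertices above level [k]; each vertex of
    level [k] costs what [mean_code_linear] says, with [decay k b] times the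
    initial number of rises. *)
Lemma mean_code_le k f b kap :
  avg_seeds kap (fun w => (code_size f b w)%:R) <=
  2 * width k b - 1 + M%:R ^+ 2 * width k b * decay k b * (rises true kap)%:R.
Proof.
have m1 := mseq_gt1 M_gt1.
elim: k f b kap => [|k IH] f b kap.
  apply: (le_trans (mean_code_linear f b kap)).
  rewrite /width /decay !big_ord0 !mulr1 lerD2r; lra.
have w1 := width_ge1 k (nextb b); have d0 := decay_gt0 k (nextb b).
have W2 : 1 <= 2 * width k.+1 b - 1 by have := width_ge1 k.+1 b; lra.
have big0 : 0 <= M%:R ^+ 2 * width k.+1 b * decay k.+1 b * (rises true kap)%:R.
  rewrite !mulr_ge0// ?exprn_ge0// ?(le_trans ler01 (width_ge1 _ _))//.
  exact: ltW (decay_gt0 _ _).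
have base : 1 <= 2 * width k.+1 b - 1 +
    M%:R ^+ 2 * width k.+1 b * decay k.+1 b * (rises true kap)%:R.
  by rewrite (le_trans W2)// lerDl.
case: f => [|f]; first by rewrite (avg_seeds_fun kap (fun=> 1)).
apply: (@le_trans _ _ (avg_seeds kap (fun w => 1 +
    \sum_(x < mseq M b 0) (code_size f (nextb b) (seed_sec x w))%:R))).
  apply: ler_avg_seeds => w wk /=; case: ifP => _.
    by rewrite lerDl sumr_ge0.
  by rewrite natrD natr_sum.
rewrite avg_seedsD (avg_seeds_fun kap (fun=> 1)) avg_seeds_sum.
rewrite (avg_seeds_sec b kap (fun w => (code_size f (nextb b) w)%:R)).
have m2 : 2 <= (mseq M b 0)%:R :> R by rewrite ler_nat m1.
move: W2 big0 base; rewrite widthS decayS /rate => W2 big0 base.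
set m := mseq M b 0 in m2 base W2 big0 *.
set u := width k (nextb b) in w1 IH W2 base big0 *.
set d := decay k (nextb b) in d0 IH W2 base big0 *.
set K : R := (rises true kap)%:R.
apply: (@le_trans _ _ (1 + m%:R * (2 * u - 1 + M%:R ^+ 2 * u * d * (rise_rate R m * K)))).
  rewrite lerD2l ler_pM2l; last by lra.
  apply: (le_trans (ler_thinning _ _ (IH f (nextb b)))).
  rewrite thinningD thinningZ thinning_cst ?m1// lerD2l ler_wpM2l ?exprn_ge0//.
    by rewrite !mulr_ge0// ?exprn_ge0// ?ltW// (lt_le_trans ltr01).
  by apply: thinning_rises_le; exact: m1.
rewrite mulrDr addrA.
rewrite (_ : m%:R * (M%:R ^+ 2 * u * d * (rise_rate R m * K)) =
  M%:R ^+ 2 * (m%:R * u) * (rise_rate R m * d) * K); last by ring.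
rewrite lerD2r mulrBr mulr1; lra.
Qed.

Fixpoint alive (k : nat) b w : nat :=
  if k is k'.+1 then (\sum_(x < mseq M b 0) alive k' (nextb b) (seed_sec x w))%N
  else (0 < rises true (map fst w))%N.

Lemma alive_le_num_visited (Lam : finGroupType) k b (W : seq (token M Lam)) :
  (alive k b (kind_seed W) <= num_visited k b W)%N.
Proof.
elim: k b W => [|k IH] b W.
  rewrite /num_visited /= addn0 -/(kinds W).
  have H : forall c, (0 < rises c (kinds W))%N -> visited W (@Defs.Root (mseq M b)).
    elim: W => [|[t|t a|a] W IHW] c //=.
    by rewrite andbF add0n => /IHW.
  by case: posnP => // /H ->.
rewrite num_visitedS /=; apply: leq_sum => x _.
by rewrite -kind_seed_section IH.
Qed.

(** Second moment method, with [al * n - be * n (n - 1)] as a lower bound for the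
    indicator of [0 < n]. The quantity [decay * (K + 1 / 3) - 1 / 3] makes the
    loss of one rise at each level harmless, because [rise_rate <= 1 / 4]. *)
Lemma mean_alive_ge (al be : R) k b kap : 0 <= al -> 0 <= be ->
  (forall n : nat, al * n%:R - be * fact2 R n <= (0 < n)%N%:R) ->
  width k b * (al * (decay k b * ((rises true kap)%:R + 3^-1) - 3^-1) -
    be * (decay k b ^+ 2 * fact2 R (rises true kap))) <=
  avg_seeds kap (fun w => (alive k b w)%:R).
Proof.
move=> al0 be0 albe; have m1 := mseq_gt1 M_gt1.
elim: k b kap => [|k IH] b kap.
  rewrite /width /decay !big_ord0 !mul1r expr1n mul1r addrK.
  by rewrite (avg_seeds_fun kap (fun k => (0 < rises true k)%N%:R)).
have -> : avg_seeds kap (fun w => (alive k.+1 b w)%:R) =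
    avg_seeds kap (fun w => \sum_(x < mseq M b 0) (alive k (nextb b) (seed_sec x w))%:R).
  by congr avg_seeds; apply/funext => w /=; rewrite natr_sum.
rewrite avg_seeds_sum (avg_seeds_sec b kap (fun w => (alive k (nextb b) w)%:R)).
rewrite widthS decayS /rate -mulrA.
have mg := m1 b 0; set m := mseq M b 0 in mg *.
have w1 := width_ge1 k (nextb b); have d0 := decay_gt0 k (nextb b).
set u := width k (nextb b) in IH w1 *; set d := decay k (nextb b) in IH d0 *.
have a0 := rise_rate_gt0 R mg; have a4 := rise_rate_le R m.
have h1 := thinning_rises_ge R mg kap; have h2 := thinning_fact2_le R mg kap.
set a := rise_rate R m in a0 a4 h1 h2 *.
rewrite ler_wpM2l//; apply: le_trans (ler_thinning _ _ (IH (nextb b))).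
set K := fun k' => (rises true k')%:R : R.
have -> : thinning m kap (fun k0 => u * (al * (d * (K k0 + 3^-1) - 3^-1) -
    be * (d ^+ 2 * fact2 R (rises true k0)))) =
  u * (al * (d * (thinning m kap K + 3^-1) - 3^-1) -
     be * (d ^+ 2 * thinning m kap (fun k0 => fact2 R (rises true k0)))).
  transitivity (thinning m kap (fun k0 => (u * al * d) * K k0 +
     ((u * al * (d * 3^-1 - 3^-1)) + (- u * be * d ^+ 2) * fact2 R (rises true k0)))).
    by congr thinning; apply/funext => k0; ring.
  by rewrite thinningD thinningZ thinningD thinning_cst// thinningZ; ring.
have u0 : 0 <= u by apply: le_trans w1.
rewrite ler_wpM2l// lerB//.
  rewrite ler_wpM2l// lerD2r [a * d]mulrC -mulrA ler_pM2l//.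
  rewrite mulrDr; apply: le_trans (_ : a * ((rises true kap)%:R - 1) + 3^-1 <= _).
    by rewrite mulrBr mulr1; lra.
  by rewrite lerD2r.
by rewrite ler_wpM2l// exprMn -[leRHS]mulrA [leRHS]mulrCA ler_wpM2l// exprn_ge0// ltW.
Qed.

(** The kinds of the steps are fair coins, see [thinning_alternating]. *)
Lemma avgn_seeds n (Phi : seq (bool * seed) -> R) :
  avgn n Phi = thinning 2 (alternating n) (fun kap => avg_seeds kap Phi).
Proof.
rewrite thinning_alternating; elim: n Phi => //= n IH Phi.
rewrite avg_pair; apply: eq_avg => c.
under eq_avg => t do rewrite IH.
by rewrite !avgnE exchange_avg; apply: eq_avg => k; rewrite avgnE.
Qed.

Lemma rise_rate2 : rise_rate R 2 = 4^-1.
Proof. by rewrite /rise_rate; lra. Qed.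

Lemma mean_code n k f b :
  avgn n (fun w => (code_size f b w)%:R) <=
  2 * width k b + M%:R ^+ 2 * width k b * (decay k b * n.-1%:R / 4).
Proof.
rewrite avgn_seeds; apply: (le_trans (ler_thinning _ _ (mean_code_le k f b))).
rewrite thinningD thinningZ thinning_cst//; apply: lerD; first by lra.
rewrite -[leLHS]mulrA -[leLHS]mulrA -[leRHS]mulrA; apply: ler_wpM2l.
  by rewrite exprn_ge0.
apply: ler_wpM2l; first exact: le_trans ler01 (width_ge1 _ _).
rewrite -mulrA; apply: ler_wpM2l; first exact: ltW (decay_gt0 _ _).
apply: (le_trans (thinning_rises_le R (isT : 1 < 2)%N (alternating n))).
by rewrite rises_alternating rise_rate2 mulrC.
Qed.

(** The quantity [x = decay k b * (n - 1) / 4], about the mean number of rises at a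
    vertex of level [k], is at least [1]. The test function is
    [1 - (1 - th * n) ^+ 2] with [th = 1 / (2 x)]. *)
Lemma mean_alive n k b : 4 <= decay k b * n.-1%:R ->
  width k b / 6 <= avgn n (fun w => (alive k b w)%:R).
Proof.
set d := decay k b => x4; have d0 : 0 < d := decay_gt0 k b.
set N : R := n.-1%:R in x4 *.
have x1 : 1 <= d * N / 4 by lra.
set x := d * N / 4 in x1.
(* this makes [th * x] constant, so the bound below does not depend on [x] *)
pose th := (2 * x)^-1.
have th0 : 0 < th by rewrite invr_gt0; lra.
have thx : th * x = 2^-1 by rewrite /th; field; rewrite gt_eqF//; lra.
have th1 : th <= 2^-1 by rewrite lef_pV2 ?posrE; lra.
pose al := 2 * th - th ^+ 2.
have al0 : 0 <= al by rewrite /al expr2 -mulrBl mulr_ge0; lra.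
have be0 : 0 <= th ^+ 2 by rewrite exprn_ge0// ltW.
have main (j : nat) : al * j%:R - th ^+ 2 * fact2 R j <= (0 < j)%N%:R.
  case: j => [|j]; first by rewrite /fact2 !mulr0 subr0.
  rewrite /= -subr_ge0.
  rewrite (_ : _ - _ = (1 - th * j.+1%:R) ^+ 2) ?sqr_ge0//.
  by rewrite /al /fact2 natrM -natr1 /=; ring.
rewrite avgn_seeds.
apply: le_trans (ler_thinning _ _ (fun kap => mean_alive_ge k b kap al0 be0 main)).
rewrite -/d; set u := width k b; have u0 : 0 <= u by rewrite (le_trans ler01)// width_ge1.
set K := fun k' => (rises true k')%:R : R.
have -> : thinning 2 (alternating n) (fun k0 => u * (al * (d * (K k0 + 3^-1) - 3^-1) -
    th ^+ 2 * (d ^+ 2 * fact2 R (rises true k0)))) =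
  u * (al * (d * (thinning 2 (alternating n) K + 3^-1) - 3^-1) -
     th ^+ 2 * (d ^+ 2 * thinning 2 (alternating n) (fun k0 => fact2 R (rises true k0)))).
  transitivity (thinning 2 (alternating n) (fun k0 => (u * al * d) * K k0 +
     ((u * al * (d * 3^-1 - 3^-1)) + (- u * th ^+ 2 * d ^+ 2) * fact2 R (rises true k0)))).
    by congr thinning; apply/funext => k0; ring.
  by rewrite thinningD thinningZ thinningD thinning_cst// thinningZ; ring.
rewrite ler_wpM2l//.
have := thinning_rises_ge R (isT : 1 < 2)%N (alternating n).
have := thinning_fact2_le R (isT : 1 < 2)%N (alternating n).
rewrite rises_alternating rise_rate2 -/N -/K.
set k1 := thinning _ _ _; set k2 := thinning _ _ _ => hk1 hk2.
have f2 : fact2 R n.-1 <= N ^+ 2.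
  by rewrite /fact2 /N -natrX ler_nat -mulnn leq_mul2l leq_pred orbT.
have e2 : th ^+ 2 * (d ^+ 2 * k1) <= 4^-1.
  apply: (@le_trans _ _ (th ^+ 2 * (d ^+ 2 * (4^-1 ^+ 2 * N ^+ 2)))).
    apply: ler_wpM2l => //; apply: ler_wpM2l; first by rewrite exprn_ge0// ltW.
    by rewrite (le_trans hk1)// ler_wpM2l// exprn_ge0// invr_ge0.
  rewrite (_ : _ * _ = (th * x) ^+ 2); last by rewrite /x; field.
  by rewrite thx; lra.
have e1 : x - 3^-1 <= d * (k2 + 3^-1) - 3^-1.
  rewrite lerD2r; apply: le_trans (_ : d * (4^-1 * (N - 1) + 3^-1) <= _).
    by rewrite /x; lra.
  by rewrite ler_pM2l// lerD2r.
apply: le_trans (_ : al * (x - 3^-1) - 4^-1 <= _); last first.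
  by rewrite lerB// ler_wpM2l.
have -> : al * (x - 3^-1) = 2 * (th * x) - th * (th * x) - 3^-1 * al.
  by rewrite /al; ring.
by rewrite thx /al; nra.
Qed.

End Means.

(** * Choosing the degrees along the growth function *)

Section Greedy.
Variable R : realType.

(** The degree [M] makes the number of vertices grow by [M] while the time scale
    grows by [M ^ 2 / (M - 1) <= 2 M]; so [2 ^ gamma <= M ^ (1 - gamma)]
    suffices. *)
Lemma large_degree (gamma : R) : 2^-1 <= gamma < 1 ->
  exists M : nat, (2 < M)%N /\ (rise_rate R M)^-1 `^ gamma <= M%:R.
Proof.
move=> /andP[g2 g1]; have g0 : 0 <= gamma by apply: le_trans g2; rewrite invr_ge0.
pose M := (Num.trunc ((2 : R) `^ (gamma / (1 - gamma)))).+3.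
exists M; split=> //; have M0 : 0 < M%:R :> R by rewrite ltr0n.
have M3 : 3 <= M%:R :> R by rewrite ler_nat.
have rM : (rise_rate R M)^-1 <= 2 * M%:R.
  rewrite /rise_rate (_ : _^-1 = M%:R ^+ 2 / (M%:R - 1)); last first.
    by field; rewrite !gt_eqF//= subr_gt0; lra.
  by rewrite ler_pdivrMr; nra.
have MM : 2 `^ gamma <= M%:R `^ (1 - gamma) :> R.
  rewrite (_ : 2 `^ gamma = (2 `^ (gamma / (1 - gamma))) `^ (1 - gamma)); last first.
    by rewrite -powRrM divfK // subr_eq0 gt_eqF.
  rewrite ge0_ler_powR ?nnegrE ?powR_ge0//; first lra.
  apply: le_trans (ltW (truncnS_gt _)) _; rewrite ler_nat /M.
  by rewrite ltnS ltnW.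
apply: (@le_trans _ _ ((2 * M%:R) `^ gamma)).
  by rewrite ge0_ler_powR ?nnegrE ?mulr_ge0// invr_ge0 ltW// rise_rate_gt0.
rewrite powRM//; apply: (@le_trans _ _ (M%:R `^ (1 - gamma) * M%:R `^ gamma)).
  by rewrite ler_wpM2r// powR_ge0.
rewrite -powRD; first by rewrite subrK powRr1// ltW.
by rewrite pnatr_eq0 /= implybT.
Qed.

Variables (gamma : R) (M : nat) (f : R -> R).
Hypothesis gamma_range : 2^-1 <= gamma < 1.
Hypothesis M_gt2 : (2 < M)%N.
Hypothesis M_large : (rise_rate R M)^-1 `^ gamma <= M%:R.
Hypothesis f1 : f 1 = 1.
Hypothesis growth : forall a n : R, 1 <= a -> 1 <= n ->
  a `^ 2^-1 * f n <= f (a * n) <= a `^ gamma * f n.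

Let M_gt1 : (1 < M)%N := ltnW M_gt2.

Lemma growth_gt0 x : 1 <= x -> 0 < f x.
Proof.
move=> x1; have /andP[h _] := growth x1 (lexx 1).
rewrite mulr1 f1 mulr1 in h; apply: lt_le_trans h; apply: powR_gt0.
exact: lt_le_trans x1.
Qed.

Lemma growth_mono x y : 1 <= x -> x <= y -> f x <= f y.
Proof.
move=> x1 xy; have x0 : 0 < x by apply: lt_le_trans x1.
have yx : 1 <= y / x by rewrite ler_pdivlMr// mul1r.
have /andP[h _] := growth yx x1.
rewrite divfK ?gt_eqF// in h; apply: le_trans h.
rewrite -[leLHS]mul1r; apply: ler_wpM2r; first exact/ltW/growth_gt0.
by rewrite -[leLHS](powRr0 (y / x)) ler_powR// invr_ge0.
Qed.

Lemma growth_linear x y : 1 <= x -> x <= y -> f y <= y / x * f x.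
Proof.
move=> x1 xy; have x0 : 0 < x by apply: lt_le_trans x1.
have yx : 1 <= y / x by rewrite ler_pdivlMr// mul1r.
have /andP[_ h] := growth yx x1.
rewrite divfK ?gt_eqF// in h; apply: (le_trans h).
apply: ler_wpM2r; first exact/ltW/growth_gt0.
rewrite -[leRHS]powRr1 ?(le_trans ler01)//.
by apply: ler_powR => //; case/andP: gamma_range => _ /ltW.
Qed.

(** The pair of the width of level [k] and of its time scale. The next degree is
    [M] when the width is behind [f], and [2] when it is ahead. *)
Fixpoint greedy_state (k : nat) : R * R :=
  if k is k'.+1 then
    let: (p, n) := greedy_state k' in
    let m := if p <= f n then M else 2 in (p * m%:R, n / rise_rate R m)
  else (1, 1).

Definition greedy (k : nat) : bool :=
  (greedy_state k).1 <= f (greedy_state k).2.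

Lemma greedy_stateE k :
  greedy_state k = (width R M k greedy, (decay R M k greedy)^-1).
Proof.
elim: k => [|k IH]; first by rewrite /width /decay !big_ord0 invr1.
rewrite /width /decay !big_ord_recr /= -/(width R M k greedy) -/(decay R M k greedy).
have : greedy k = (width R M k greedy <= f (decay R M k greedy)^-1).
  by rewrite {1}/greedy IH.
by rewrite IH /rate /mseq => ->; rewrite [in RHS]invfM.
Qed.

Lemma rate_bounds b i : 4 <= (rate R M b i)^-1 <= M%:R ^+ 2.
Proof.
have r0 m : (1 < m)%N -> 4 <= (rise_rate R m)^-1.
  move=> m1; rewrite -[leLHS]invrK lef_pV2 ?posrE ?invr_gt0 ?rise_rate_gt0//.
  exact: rise_rate_le.
have M3 : 3 <= M%:R :> R by rewrite ler_nat.
rewrite /rate r0 ?mseq_gt1//= /mseq; case: (b i); last by rewrite rise_rate2 invrK; nra.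
rewrite /rise_rate (_ : _^-1 = M%:R ^+ 2 / (M%:R - 1)); last first.
  by field; rewrite !gt_eqF//= ?subr_gt0; lra.
rewrite ler_pdivrMr; last by lra.
by rewrite -[leLHS]mulr1 ler_wpM2l ?exprn_ge0//; lra.
Qed.

Definition scale k : R := (decay R M k greedy)^-1.

Lemma scaleE k : scale k.+1 = (rate R M greedy k)^-1 * scale k.
Proof. by rewrite /scale /decay big_ord_recr /= invfM mulrC. Qed.

Lemma scaleS k : 4 * scale k <= scale k.+1 <= M%:R ^+ 2 * scale k.
Proof.
have /andP[h1 h2] := rate_bounds greedy k.
have d0 : 0 <= scale k by rewrite invr_ge0 ltW// decay_gt0.
by rewrite scaleE; apply/andP; split; apply: ler_wpM2r.
Qed.

Lemma scale_ge k : 4 ^+ k <= scale k.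
Proof.
elim: k => [|k IH]; first by rewrite /scale /decay big_ord0 invr1.
have /andP[h _] := scaleS k; apply: le_trans h.
by rewrite exprS ler_wpM2l.
Qed.

Lemma scale_ge1 k : 1 <= scale k.
Proof. by apply: le_trans (scale_ge k); rewrite exprn_ege1// ler1n. Qed.

Lemma scale_exists (t : R) : 1 <= t -> exists k, scale k <= t < scale k.+1.
Proof.
move=> t1.
have ex : exists k, t < scale k.
  exists (Num.trunc t).+1; apply: lt_le_trans (scale_ge _).
  apply: lt_le_trans (truncnS_gt t) _.
  by rewrite -natrX ler_nat ltnW// ltn_expl.
case: (ex_minnP ex) => -[|k] tk mink.
  by move: tk; rewrite /scale /decay big_ord0 invr1 ltNge t1.
exists k; rewrite tk andbT leNgt; apply/negP => /mink; by rewrite ltnn.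
Qed.

(** With degree [2] the width doubles and the time scale is multiplied by [4], so
    that [f] at least doubles; with degree [M] the width grows by [M], and [f] by
    at most [M] by the choice of [M]. Hence the ratio of width to [f] moves towards
    [1] at each step, up to one overshoot. *)
Lemma greedy_width k :
  2^-1 * f (scale k) <= width R M k greedy <= M%:R * f (scale k).
Proof.
have M3 : 3 <= M%:R :> R by rewrite ler_nat.
elim: k => [|k /andP[IH1 IH2]].
  by rewrite /width /scale /decay !big_ord0 invr1 f1; apply/andP; split; lra.
have s1 := scale_ge1 k; have fs := growth_gt0 s1.
have /andP[r4 _] := rate_bounds greedy k.
have r1 : 1 <= (rate R M greedy k)^-1 by lra.
have /andP[g1 g2] := growth r1 s1; rewrite -scaleE in g1 g2.
have s1' := scale_ge1 k.+1; have fs' := growth_gt0 s1'.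
have -> : width R M k.+1 greedy = width R M k greedy * (mseq M greedy k)%:R.
  by rewrite /width big_ord_recr.
have gk : greedy k = (width R M k greedy <= f (scale k)).
  by rewrite /greedy greedy_stateE.
move: g1 g2; rewrite /rate /mseq; case: ifP; rewrite gk => pf g1 g2.
  have ff : f (scale k) <= f (scale k.+1).
    by apply: growth_mono => //; have /andP[h _] := scaleS k; apply: le_trans h; lra.
  have ff' : f (scale k.+1) <= M%:R * f (scale k).
    by apply: (le_trans g2); apply: ler_wpM2r => //; exact: ltW.
  apply/andP; split; last by rewrite mulrC ler_pM2l ?(le_trans pf)//; lra.
  apply: le_trans (_ : 2^-1 * (M%:R * f (scale k)) <= _).
    by rewrite ler_wpM2l.
  by rewrite mulrCA mulrC ler_wpM2r.
move/negbT: pf; rewrite -ltNge => pf.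
rewrite rise_rate2 invrK in g1 g2.
have four : (4 : R) = 2 `^ 2 by rewrite -[2 in X in _ `^ X]/(2%:R) powR_mulrn//; lra.
have h4 : (4 : R) `^ 2^-1 = 2.
  by rewrite four -powRrM mulfV// powRr1.
have g4 : (4 : R) `^ gamma <= 4.
  rewrite -[leRHS]powRr1//; apply: ler_powR; first lra.
  by case/andP: gamma_range => _ /ltW.
rewrite h4 in g1.
have g2' : f (scale k.+1) <= 4 * f (scale k).
  by apply: (le_trans g2); apply: ler_wpM2r => //; exact: ltW.
apply/andP; split; first lra.
by nra.
Qed.

(** Level [k] is the one whose time scale is comparable to [n]. *)
Lemma greedy_upper n : (1 <= n)%N -> exists k,
  2 * width R M k greedy +
    M%:R ^+ 2 * width R M k greedy * (decay R M k greedy * n.-1%:R / 4) <=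
  M%:R * (2 + M%:R ^+ 4) * f n%:R.
Proof.
move=> n1; have n1' : 1 <= n%:R :> R by rewrite ler1n.
have [k /andP[sn ns]] := scale_exists n1'; exists k.
have /andP[_ w] := greedy_width k; have fm := growth_mono (scale_ge1 k) sn.
have d0 : 0 < decay R M k greedy := decay_gt0 R M_gt1 k greedy.
have /andP[_ s2] := scaleS k.
have w0 : 0 < width R M k greedy by apply: lt_le_trans (width_ge1 R M_gt1 _ _).
have x : decay R M k greedy * n.-1%:R / 4 <= M%:R ^+ 2.
  apply: (@le_trans _ _ (decay R M k greedy * n%:R)).
    rewrite -mulrA ler_pM2l// ler_pdivrMr// (@le_trans _ _ n%:R)//.
      by rewrite ler_nat leq_pred.
    by rewrite ler_peMr// ?ler1n.
  rewrite mulrC -ler_pdivlMr//; apply: le_trans s2; exact: ltW.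
have M0 : 0 <= M%:R ^+ 2 :> R by rewrite exprn_ge0.
apply: (@le_trans _ _ (width R M k greedy * (2 + M%:R ^+ 4))).
  have -> : (M%:R ^+ 4 : R) = M%:R ^+ 2 * M%:R ^+ 2 by rewrite -exprD.
  rewrite mulrDr [_ * 2]mulrC lerD2l -mulrA mulrCA ler_pM2l//.
  by rewrite ler_wpM2l.
rewrite mulrAC ler_wpM2r ?addr_ge0 ?exprn_ge0//.
by apply: (le_trans w); rewrite ler_wpM2l.
Qed.

(** The fair coins give about [n / 4] rises, which replaces [n] by [n / 4] in the
    comparison with the time scales and leaves out finitely many [n]. *)
Lemma greedy_lower n : (1 <= n)%N ->
  f n%:R <= 5 \/
  exists k, 4 <= decay R M k greedy * n.-1%:R /\
    f n%:R <= 16 * M%:R ^+ 2 * width R M k greedy.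
Proof.
move=> n1; have n1' : 1 <= n%:R :> R by rewrite ler1n.
have nE : n%:R = n.-1%:R + 1 :> R by rewrite natr1 prednK.
have [n4|n4] := ltP (n.-1%:R : R) 4.
  left; have := growth_linear (lexx 1) n1'; rewrite divr1 f1 mulr1 => h.
  by apply: (le_trans h); lra.
right; have t1 : 1 <= n.-1%:R / 4 :> R by lra.
have [k /andP[sn ns]] := scale_exists t1; exists k.
have d0 : 0 < decay R M k greedy := decay_gt0 R M_gt1 k greedy.
split.
  move: sn; rewrite /scale -[_^-1]mul1r ler_pdivrMr// => sn; lra.
have /andP[w _] := greedy_width k; have /andP[_ s2] := scaleS k.
have s1 := scale_ge1 k; have fs := growth_gt0 s1.
have s0 : 0 < scale k by lra.
have sn' : scale k <= n%:R by lra.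
apply: (le_trans (growth_linear s1 sn')).
have nb : n%:R / scale k <= 8 * M%:R ^+ 2 by rewrite ler_pdivrMr// -mulrA; lra.
apply: (@le_trans _ _ (8 * M%:R ^+ 2 * f (scale k))).
  by rewrite ler_wpM2r// ltW.
have M0 : 0 <= M%:R ^+ 2 :> R by rewrite exprn_ge0.
by nra.
Qed.

End Greedy.

(** * The mother group and the step law *)

Section Generators.
Variables (R : realType) (M : nat).
Hypothesis M_gt2 : (2 < M)%N.
Local Notation seed := ('S_2 * 'S_M)%type.
Variable b : nat -> bool.

Lemma mseq_deg_ge2 i : (2 <= mseq M b i)%N.
Proof. exact: mseq_gt1 (ltnW M_gt2) b i. Qed.

Lemma mseq_bounded : exists B, forall i, (mseq M b i <= B)%N.
Proof. by exists M => i; rewrite /mseq; case: (b i) => //; apply: ltnW. Qed.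

Definition mdegseq : degseq := DegSeq mseq_deg_ge2 mseq_bounded.

Definition gen_aut (c : bool * seed) : aut (mseq M b) :=
  if c.1 then propagating (fun i => perm_at b i c.2) else rooted (perm_at b 0 c.2).

Lemma perm_at_value_dependent (t : seed) : value_dependent (fun i => perm_at b i t).
Proof.
move=> i j; rewrite /perm_at /mseq; case: (b i); case: (b j) => e.
- by rewrite cast_perm_id.
- by exfalso; move: M_gt2; rewrite e.
- by exfalso; move: M_gt2; rewrite -e.
- by rewrite cast_perm_id.
Qed.

Lemma perm_at_surj i (u : 'S_(mseq M b i)) : exists t : seed, perm_at b i t = u.
Proof.
rewrite /perm_at; move: u; rewrite /mseq; case: (b i) => u.
  by exists (1%g, u).
by exists (u, 1%g).
Qed.

Lemma perm_at_component i (s t : seed) :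
  (if b i then s.2 = t.2 else s.1 = t.1) -> perm_at b i s = perm_at b i t.
Proof. by rewrite /perm_at /mseq; case: (b i). Qed.

Lemma Sym_rootedE : @Sym_rooted (mseq M b) = range (fun t : seed => gen_aut (false, t)).
Proof.
apply/seteqP; split=> [_ [u _ <-]|_ [t _ <-]]; last by exists (perm_at b 0 t).
by have [t <-] := perm_at_surj u; exists t.
Qed.

(** A value dependent family is determined by the permutation that it takes for
    each of the two degrees; since [M != 2], every seed is allowed. *)
Lemma PropagatingE : @Propagating (mseq M b) = range (fun t : seed => gen_aut (true, t)).
Proof.
apply/seteqP; split=> [_ [u uv <-]|_ [t _ <-]]; last first.
  by exists (fun i => perm_at b i t) => //; exact: perm_at_value_dependent.
have part k : exists t : seed, forall i, b i = k -> perm_at b i t = u i.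
  have [[j bj]|nk] := pselect (exists i, b i = k); last first.
    by exists 1%g => i bi; case: nk; exists i.
  have [t tj] := perm_at_surj (u j); exists t => i bi.
  have e : mseq M b j = mseq M b i by rewrite /mseq bj bi.
  by rewrite -(perm_at_value_dependent t e) tj; exact: uv.
have [t0 t0u] := part false; have [t1 t1u] := part true.
have tu i : perm_at b i (t0.1, t1.2) = u i.
  by case bi: (b i); rewrite -?(t0u i bi) -?(t1u i bi); apply: perm_at_component;
    rewrite bi.
exists (t0.1, t1.2) => //; congr propagating.
by apply: functional_extensionality_dep => i; exact: tu.
Qed.

Lemma gen_aut_in c : gen_aut c \in @mother_set (mseq M b).
Proof.
apply/mem_set => B /= [_ AB]; apply: AB.
case: c => -[] t; [left|right]; rewrite ?PropagatingE ?Sym_rootedE; by exists t.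
Qed.

(** A fair coin chooses between rooted and propagating, a uniform seed chooses the
    permutation. *)
Definition gen (c : bool * seed) : mother (mseq M b) := exist _ (gen_aut c) (gen_aut_in c).

Lemma gen_autM k s t : gen_aut (k, (s * t)%g) = (gen_aut (k, s) * gen_aut (k, t))%g.
Proof. by case: k; rewrite /gen_aut /= ?propM ?rootedM. Qed.

Lemma genM k s t : gen (k, (s * t)%g) = (gen (k, s) * gen (k, t))%g.
Proof. by apply: val_inj; rewrite /= gen_autM. Qed.

(** Products of generators form a group, as the inverse of a generator is a
    generator. In particular the mother group is countable, which makes events on
    the walk measurable. *)
Lemma mother_generated (g : mother (mseq M b)) :
  exists s : seq (bool * seed), g = (\prod_(c <- s) gen c)%g.
Proof.
pose B : set (aut (mseq M b)) := range (fun s : seq (bool * seed) => (\prod_(c <- s) gen_aut c)%g).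
have ga1 k : gen_aut (k, 1%g) = 1%g by case: k; rewrite /gen_aut /= ?prop1 ?rooted1.
have gaV c : gen_aut (c.1, (c.2)^-1%g) = (gen_aut c)^-1%g.
  by case: c => k t; apply: (mulIg (gen_aut (k, t))); rewrite mulVg -gen_autM mulVg ga1.
have : B (val g).
  have /set_mem : val g \in @mother_set (mseq M b) by exact: valP.
  apply; split; [split|].
  - by rewrite inE; exists [::] => //; rewrite big_nil.
  - move=> h1 h2; rewrite !inE => -[s1 _ <-] [s2 _ <-].
    exists (s1 ++ rev [seq (c.1, (c.2)^-1%g) | c <- s2]) => //.
    rewrite big_cat /=; congr (_ * _)%g.
    elim: s2 => [|c s2 IH]; first by rewrite !big_nil invg1.
    by rewrite /= rev_cons -cats1 big_cat /= IH !big_cons big_nil mulg1 gaV invMg.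
  - by rewrite PropagatingE Sym_rootedE => h [] [t _ <-];
      [exists [:: (true, t)]|exists [:: (false, t)]]; rewrite // big_seq1.
move=> [s _ sg]; exists s; apply: val_inj; rewrite -sg.
elim: s {sg} => [|c s IH]; first by rewrite !big_nil.
by rewrite !big_cons /= IH.
Qed.

Lemma val_preim (A : set (aut (mseq M b))) k :
  A = range (fun t : seed => gen_aut (k, t)) ->
  (val @^-1` A = range (fun t : seed => gen (k, t)) :> set (mother (mseq M b)))%classic.
Proof.
move=> ->; apply/seteqP; split=> [g [t _ tg]|_ [t _ <-]]; last by exists t.
by exists t => //; apply: val_inj.
Qed.

(** The seeds form a group and [gen] is a morphism on each kind, so all its
    nonempty fibres have the same size. *)
Lemma uniform_on_range k (g : mother (mseq M b)) :
  uniform_on R (range (fun t : seed => gen (k, t))) g =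
  pmf R (fun t : seed => gen (k, t)) g.
Proof.
set phi := fun t : seed => gen (k, t); set A := range phi.
have finA : finite_set A by exact/finite_image/finite_finset.
have O0 : (0 < #|{: seed}|)%N by apply/card_gt0P; exists 1%g.
have const t : pmf R phi (phi t) = pmf R phi (phi 1%g).
  rewrite /pmf -(@avg_bij _ _ _ (mulg t)) /=.
    apply: eq_avg => s; congr (_ : bool)%:R.
    rewrite /phi genM -[X in _ == X]mulg1 (inj_eq (mulgI _)).
    have -> // : gen (k, 1%g) = 1%g.
    by apply: (mulgI (gen (k, 1%g))); rewrite -genM !mulg1.
  by exists (mulg t^-1)%g => s; rewrite ?mulKg ?mulKVg.
have sum1 : \sum_(x <- fset_set A) pmf R phi x = 1.
  rewrite -avg_sum -[RHS](avg_cst _ O0); apply: eq_avg => t.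
  rewrite (bigD1_seq (phi t)) ?fset_uniq//=; last first.
    by rewrite in_fset_set// inE; exists t.
  rewrite eqxx big1 ?addr0// => x; by rewrite eq_sym => /negPf ->.
rewrite /uniform_on; case: ifPn => gA; last first.
  rewrite /pmf /avg big1 ?mulr0// => t _.
  by case: eqP => // tg; case/negP: gA; rewrite inE; exists t.
have [t _ <-] := set_mem gA.
have : (#|` fset_set A|)%:R * pmf R phi (phi t) = 1.
  rewrite mulr_natl -[RHS]sum1 [RHS](eq_big_seq (fun=> pmf R phi (phi t))).
    by rewrite big_const_seq iter_addr_0 count_predT.
  by move=> x; rewrite in_fset_set// inE => -[s _ <-]; rewrite !const.
have p0 : pmf R phi (phi t) != 0 by rewrite gt_eqF ?pmf_gt0.
by move=> /(canRL (mulfK p0)) ->; rewrite div1r invrK.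
Qed.

Lemma mother_lawE (g : mother (mseq M b)) :
  mother_law R g = pmf R gen g.
Proof.
rewrite /mother_law (val_preim Sym_rootedE) (val_preim PropagatingE).
rewrite !uniform_on_range.
transitivity (avg (fun k : bool => avg (fun t : seed => (gen (k, t) == g)%:R : R))).
  by rewrite avg_bool mulrDr addrC.
by symmetry; exact: (avg_pair (fun c : bool * seed => (gen c == g)%:R)).
Qed.

End Generators.

(** * Random variables with the law of a finite model *)

Section FiniteLaw.
Variables (R : realType) (d : measure_display) (T : measurableType d).
Variable P : probability T R.
Local Open Scope classical_set_scope.

Lemma prob_mem (C : eqType) (V : T -> C) (s : seq C) : uniq s ->
  (forall c, measurable (V @^-1` [set c])) ->
  measurable (V @^-1` [set` s]) /\
  P (V @^-1` [set` s]) = (\sum_(c <- s) P (V @^-1` [set c]))%E.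
Proof.
move=> us mV; elim: s us => [_|c s IH /= /andP[cs us]].
  have -> : V @^-1` [set` [::]] = set0 by apply/seteqP; split.
  by rewrite big_nil measure0.
have [ms es] := IH us.
have -> : V @^-1` [set` c :: s] = V @^-1` [set c] `|` V @^-1` [set` s].
  apply/seteqP; split=> t /=; rewrite inE; first by move=> /orP[/eqP|]; [left|right].
  by move=> [->|->]; rewrite ?eqxx ?orbT.
split; first exact: measurableU.
rewrite measureU//; first by rewrite big_cons; congr (_ + _)%E; exact: es.
by apply/seteqP; split=> // t [/= ->]; rewrite (negPf cs).
Qed.

(** The image of [v] carries the whole mass of [V], so it is enough to bound both
    [x] and its complement from below by finite sums. *)
Lemma prob_finite_law (O : finType) (C D : eqType) (V : T -> C) (v : O -> C)
    (Phi : C -> D) (x : D) : (0 < #|O|)%N ->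
  (forall c, measurable (V @^-1` [set c])) ->
  (forall c, P (V @^-1` [set c]) = (pmf R v c)%:E) ->
  measurable ((Phi \o V) @^-1` [set x]) ->
  P ((Phi \o V) @^-1` [set x]) = (pmf R (Phi \o v) x)%:E.
Proof.
move=> O0 mV PV mx.
have lower (A : pred C) : measurable (V @^-1` [set` A]) ->
    ((avg (fun w => (A (v w))%:R : R))%:E <= P (V @^-1` [set` A]))%E.
  move=> mA; pose s := [seq c <- values v | A c].
  have us : uniq s by rewrite filter_uniq// undup_uniq.
  have [ms es] := prob_mem us mV.
  apply: (@le_trans _ _ (P (V @^-1` [set` s]))); last first.
    apply: le_measure; rewrite ?inE// => t /=.
    by rewrite mem_filter => /andP[].
  rewrite es (eq_bigr (fun c => (pmf R v c)%:E)) => [|c _]; last exact: PV.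
  rewrite sumEFin lee_fin big_filter big_mkcond /= (avg_values v (fun c => (A c)%:R)).
  apply: ler_sum => c _; case: ifP => _; by rewrite ?mulr1 ?mulr0.
pose A := [pred c | Phi c == x].
have AE : (Phi \o V) @^-1` [set x] = V @^-1` [set` A].
  by apply/seteqP; split=> t /=; rewrite inE => /eqP.
have mA : measurable (V @^-1` [set` A]) by rewrite -AE.
have CE : V @^-1` [set` predC A] = ~` (V @^-1` [set` A]).
  by apply/seteqP; split=> t /=; rewrite !inE => /negP.
have mC : measurable (V @^-1` [set` predC A]) by rewrite CE; exact: measurableC.
have h1 := lower A mA; have h2 := lower (predC A) mC.
have e1 : pmf R (Phi \o v) x = avg (fun w => (A (v w))%:R) by [].
have e2 : avg (fun w => (predC A (v w))%:R) = 1 - pmf R (Phi \o v) x.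
  rewrite -[X in X - _](avg_cst _ O0) e1 -mulN1r -avgZ -avgD.
  by apply: eq_avg => w /=; case: (_ == x); rewrite /= ?mulr1 ?mulr0 ?subrr ?addr0.
rewrite AE; rewrite CE probability_setC// e2 in h2; rewrite -e1 in h1.
move: h1 h2; rewrite -(@fineK _ (P (V @^-1` [set` A]))) ?fin_num_measure//.
rewrite -EFinB !lee_fin => h1 h2; congr EFin.
by apply/eqP; rewrite eq_le h1 andbT; lra.
Qed.

Lemma entropy_finite (O : finType) (D : choiceType) (V : T -> D) (X : O -> D) :
  (0 < #|O|)%N ->
  (forall x, P (V @^-1` [set x]) = (pmf R X x)%:E) ->
  entropy P V = (fentropy R X)%:E.
Proof.
move=> O0 PV; pose h x := (- (pmf R X x * ln (pmf R X x)) : R)%R.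
have -> : entropy P V = \esum_(x in setT) (h x)%:E.
  by apply: eq_esum => x _; rewrite PV.
have h0 x : (0 <= h x)%R.
  rewrite /h -mulrN mulr_ge0 ?pmf_ge0// oppr_ge0 ln_le0//.
  by have := sum_pmf_le1 R X O0 (s := [:: x]) isT; rewrite big_seq1; exact.
have -> : \esum_(x in setT) (h x)%:E = \esum_(x in [set` values X]) (h x)%:E.
  rewrite [RHS]esum_mkcond; apply: eq_esum => x _; case: ifPn => // xX.
  rewrite /h pmf_eq0 ?mul0r ?oppr0//; apply: contra xX => xX.
  by rewrite inE.
rewrite esum_fset//; last by move=> x _; rewrite lee_fin.
rewrite -fsbig_seq ?undup_uniq// sumEFin; congr EFin.
by rewrite fentropyE.
Qed.

End FiniteLaw.

(** * The law of the walk *)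

Section WalkLaw.
Variables (R : realType) (M : nat) (M_gt2 : (2 < M)%N) (b : nat -> bool).
Variable Lam : finGroupType.
Local Notation seed := ('S_2 * 'S_M)%type.
Local Notation m := (mdegseq M_gt2 b).
Local Notation act := (mother_act m).
Local Notation W := (wreath Lam act).

Definition sws_step (g : mother m) (p : Lam * Lam) : W :=
  (lamp_at act (origin m) p.1 * of_base Lam act g * lamp_at act (origin m) p.2)%g.

Fixpoint walk_of (cg : seq (mother m)) (cl : seq (Lam * Lam)) : W :=
  match cg, cl with
  | g :: cg', p :: cl' => (sws_step g p * walk_of cg' cl')%g
  | _, _ => 1%g
  end.

Lemma avgn_map (A : finType) (E : eqType) (phi : A -> E) n (c : seq E) :
  avgn n (fun s => (map phi s == c)%:R : R) =
  (size c == n)%:R * \prod_(x <- c) pmf R phi x.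
Proof.
elim: n c => [|n IH] [|x c] /=; rewrite ?mul0r ?big_nil ?mulr1//.
  by rewrite /avg big1 ?mulr0// => a _; rewrite avgnE /avg big1 ?mulr0.
rewrite eqSS big_cons mulrCA -IH /pmf -[RHS]mulrC -avgZ; apply: eq_avg => a.
rewrite mulrC -avgnZ; apply: eq_avgn => s _.
by rewrite eqseq_cons; case: eqP; rewrite ?mul1r ?mul0r.
Qed.

Variables (d : measure_display) (T : measurableType d) (P : probability T R).
Variables (L : nat -> T -> Lam) (G : nat -> T -> mother m) (L' : nat -> T -> Lam).
Hypothesis steps : sws_steps P (uniform_on R [set: Lam]%classic)
  (@mother_law R m) L G L'.

Definition sample n t : seq (mother m) * seq (Lam * Lam) :=
  ([seq G i t | i <- iota 0 n], [seq (L i t, L' i t) | i <- iota 0 n]).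

Lemma sws_walkE n :
  sws_walk act (origin m) L G L' n = (fun c => walk_of c.1 c.2) \o sample n.
Proof.
apply/funext => t; rewrite /sws_walk /sample /=.
suff shifted k : (\prod_(i < n) sws_step (G (k + i)%N t) (L (k + i)%N t, L' (k + i)%N t))%g =
    walk_of [seq G i t | i <- iota k n] [seq (L i t, L' i t) | i <- iota k n].
  exact: (shifted 0).
elim: n k => [|n IH] k; first by rewrite big_ord0.
rewrite big_ord_recl /= addn0 -IH; congr (_ * _)%g.
by apply: eq_bigr => i _; rewrite /bump /= add1n addSnnS.
Qed.

Definition finite_sample n (w : n.-tuple (bool * seed) * n.-tuple (Lam * Lam)) :
    seq (mother m) * seq (Lam * Lam) :=
  (map (gen M_gt2 b) w.1, tval w.2).

Lemma lamE a : uniform_on R [set: Lam]%classic a = #|Lam|%:R^-1.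
Proof.
rewrite /uniform_on in_setT; congr (_%:R^-1).
rewrite cardE; apply/perm_size/uniq_perm; rewrite ?fset_uniq ?enum_uniq// => x.
rewrite mem_enum in_fset_set; first by rewrite in_setT inE.
exact: (@finite_finset Lam).
Qed.

Lemma pmf_id (p : Lam * Lam) : pmf R id p = #|Lam|%:R^-1 * #|Lam|%:R^-1.
Proof.
rewrite /pmf /avg (bigD1 p)//= eqxx big1 ?addr0 ?mulr1; last by move=> q /negPf ->.
by rewrite card_prod natrM invfM.
Qed.

Lemma pmf_finite_sample n (c : seq (mother m) * seq (Lam * Lam)) :
  pmf R (@finite_sample n) c =
  ((size c.1 == n) && (size c.2 == n))%:R *
  (\prod_(g <- c.1) mother_law R g *
   \prod_(p <- c.2) (uniform_on R [set: Lam]%classic p.1 * uniform_on R [set: Lam]%classic p.2)).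
Proof.
case: c => cg cl /=.
transitivity (avgn n (fun s => (map (gen M_gt2 b) s == cg)%:R) *
  avgn n (fun s => (map id s == cl)%:R) : R); last first.
  rewrite !avgn_map mulrACA -natrM mulnb; congr (_ * (_ * _)).
    by apply: eq_bigr => g _; rewrite mother_lawE.
  by apply: eq_bigr => p _; rewrite pmf_id !lamE.
rewrite !avgnE mulrC -avgZ /pmf avg_pair; apply: eq_avg => y.
rewrite mulrC -avgZ; apply: eq_avg => l; rewrite map_id -natrM mulnb.
by rewrite xpair_eqE.
Qed.

Local Open Scope classical_set_scope.

(** The event is a finite intersection of events on single factors, and the
    probabilities multiply by independence. *)
Lemma sample_measurable n c : measurable (sample n @^-1` [set c]) /\
  P (sample n @^-1` [set c]) = (pmf R (@finite_sample n) c)%:E.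
Proof.
case: c => cg cl; rewrite pmf_finite_sample /=.
case: (boolP ((size cg == n) && (size cl == n))) => [/andP[/eqP sg /eqP sl]|nsz]; last first.
  have -> : sample n @^-1` [set (cg, cl)] = set0.
    apply/seteqP; split=> // t [eg el]; case/negP: nsz.
    by rewrite -eg -el !size_map !size_iota eqxx.
  by rewrite measure0 mul0r.
pose A (j : nat + nat + nat) : set T := match j with
  | inl (inl i) => L i @^-1` [set (nth (1%g, 1%g) cl i).1]
  | inl (inr i) => G i @^-1` [set nth 1%g cg i]
  | inr i => L' i @^-1` [set (nth (1%g, 1%g) cl i).2]
  end.
pose J : seq (nat + nat + nat) := [seq inl (inl i) | i <- iota 0 n] ++
  [seq inl (inr i) | i <- iota 0 n] ++ [seq inr i | i <- iota 0 n].
have SA : sample n @^-1` [set (cg, cl)] = \bigcap_(j in [set` J]) A j.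
  apply/seteqP; split=> t.
    move=> [eg el] j /=; rewrite !mem_cat => /or3P[] /mapP[i];
      rewrite mem_iota /= add0n => iN -> /=.
    - by rewrite -el (nth_map 0) ?size_iota// nth_iota.
    - by rewrite -eg (nth_map 0) ?size_iota// nth_iota.
    - by rewrite -el (nth_map 0) ?size_iota// nth_iota.
  move=> tA; rewrite /sample /=; congr pair.
    apply: (@eq_from_nth _ 1%g); rewrite size_map size_iota ?sg// => i iN.
    rewrite (nth_map 0) ?size_iota// nth_iota// add0n.
    by apply: (tA (inl (inr i))); rewrite /= !mem_cat map_f ?orbT ?mem_iota.
  apply: (@eq_from_nth _ (1%g, 1%g)); rewrite size_map size_iota ?sl// => i iN.
  rewrite (nth_map 0) ?size_iota// nth_iota// add0n.
  have -> : L i t = (nth (1%g, 1%g) cl i).1.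
    by apply: (tA (inl (inl i))); rewrite /= !mem_cat map_f ?mem_iota.
  have -> : L' i t = (nth (1%g, 1%g) cl i).2.
    by apply: (tA (inr i)); rewrite /= !mem_cat [X in [|| _, _ | X]]map_f ?orbT ?mem_iota.
  by rewrite -surjective_pairing.
have mA j : measurable (A j).
  case: j => [[i|i]|i]; [exact: (sws_L steps i).1|exact: (sws_G steps i).1|
    exact: (sws_L' steps i).1].
have uJ : uniq J.
  have inj1 : injective (fun i : nat => inl (inl i) : nat + nat + nat) by move=> i j [].
  have inj2 : injective (fun i : nat => inl (inr i) : nat + nat + nat) by move=> i j [].
  have inj3 : injective (fun i : nat => inr i : nat + nat + nat) by move=> i j [].
  rewrite !cat_uniq !map_inj_uniq ?iota_uniq//= andbT; apply/andP; split.
    apply/hasPn => j; rewrite mem_cat => /orP[] /mapP[i _ ->]; apply/mapP; by case.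
  by apply/hasPn => j /mapP[i _ ->]; apply/mapP; case.
split; first by rewrite SA; apply: fin_bigcap_measurable => //; exact: finite_seq.
rewrite SA (sws_indep steps uJ); last first.
  move=> [[i|i]|i] _ /=; rewrite /discrete_sigma /preimage_set_system /=.
  - by exists [set (nth (1%g, 1%g) cl i).1] => //; rewrite setTI.
  - by exists [set nth 1%g cg i] => //; rewrite setTI.
  - by exists [set (nth (1%g, 1%g) cl i).2] => //; rewrite setTI.
rewrite !big_cat !big_map /=.
transitivity ((\prod_(i <- iota 0 n) uniform_on R setT (nth (1%g, 1%g) cl i).1)%:E *
   ((\prod_(i <- iota 0 n) mother_law R (nth 1%g cg i))%:E *
    (\prod_(i <- iota 0 n) uniform_on R setT (nth (1%g, 1%g) cl i).2)%:E))%E.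
  rewrite -!prodEFin; congr (_ * (_ * _))%E; apply: eq_bigr => i _.
  - exact: (sws_L steps i).2.
  - exact: (sws_G steps i).2.
  - exact: (sws_L' steps i).2.
rewrite -!EFinM; congr EFin; rewrite mul1r.
rewrite mulrCA -big_split /=; congr (_ * _).
  by rewrite [RHS](big_nth 1%g) sg /index_iota subn0.
by rewrite [RHS](big_nth (1%g, 1%g)) sl /index_iota subn0.
Qed.

(** Increments of the walk are words in finitely many generators, so the event is
    a countable union of cylinders. *)
Lemma walk_law n (x : W) :
  P (sws_walk act (origin m) L G L' n @^-1` [set x]) =
  (pmf R ((fun c => walk_of c.1 c.2) \o @finite_sample n) x)%:E.
Proof.
rewrite sws_walkE; apply: prob_finite_law.
- rewrite card_prod !card_tuple muln_gt0 !expn_gt0; apply/andP; split.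
    by rewrite (_ : 0 < _)%N//; apply/card_gt0P; exists (true, 1%g).
  by rewrite (_ : 0 < _)%N//; apply/card_gt0P; exists 1%g.
- by move=> c; exact: (sample_measurable n c).1.
- by move=> c; exact: (sample_measurable n c).2.
pose dec (u : seq (seq (bool * seed)) * seq (Lam * Lam)) : seq (mother m) * seq (Lam * Lam) :=
  ([seq (\prod_(c <- s) gen M_gt2 b c)%g | s <- u.1], u.2).
have dec_surj c : exists u, dec u = c.
  case: c => cg cl; suff [u1 e] : exists u1, (dec (u1, [::])).1 = cg.
    by exists (u1, cl); rewrite /dec -e.
  elim: cg => [|g cg [u1 e]]; first by exists [::].
  have [s gs] := mother_generated M_gt2 g.
  by exists (s :: u1); rewrite /dec /= gs; congr cons.
have -> : ((fun c => walk_of c.1 c.2) \o sample n) @^-1` [set x] =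
  \bigcup_(u : seq (seq (bool * seed)) * seq (Lam * Lam))
     (if walk_of (dec u).1 (dec u).2 == x then sample n @^-1` [set dec u] else set0).
  apply/seteqP; split=> t.
    move=> tx; have [u us] := dec_surj (sample n t); exists u => //.
    by rewrite us; case: eqP => // -[].
  by move=> [u _]; case: eqP => // ux us; rewrite -ux -(us : sample n t = dec u).
apply: countable_bigcupT_measurable.
  exact: countableP.
by move=> u; case: eqP => // _; exact: (sample_measurable n _).1.
Qed.

End WalkLaw.

(** * Entropy of the walk *)

Section WalkEntropy.
Variables (R : realType) (M : nat) (M_gt2 : (2 < M)%N) (b : nat -> bool).
Variable Lam : finGroupType.
Local Notation seed := ('S_2 * 'S_M)%type.
Local Notation m := (mdegseq M_gt2 b).
Local Notation W := (wreath Lam (mother_act m)).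
Local Notation walk y l := (@walk_of M M_gt2 b Lam (map (gen M_gt2 b) y) l).

(** The lamp change after a propagating action is merged with it. *)
Fixpoint word_of (y : seq (bool * seed)) (l : seq (Lam * Lam)) : seq (token M Lam) :=
  match y, l with
  | (k, t) :: y', (p, q) :: l' =>
      if k then Lp M p :: Pr t q :: word_of y' l'
      else Lp M p :: Sy Lam t :: Lp M q :: word_of y' l'
  | _, _ => [::]
  end.

Lemma kind_seed_word_of y l : size y = size l -> kind_seed (word_of y l) = y.
Proof.
elim: y l => [|[[] t] y IH] [|[p q] l] //= [yl]; congr cons; exact: IH.
Qed.

Lemma base_walk y l : val (base (walk y l)) = word_aut b (word_of y l).
Proof.
elim: y l => [|[k t] y IH] [|[p q] l] //=.
by case: k; rewrite /= -IH !mul1g mulg1.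
Qed.

Lemma orbit_eq_origin (s : orbit_word m) : `[< s = origin m >] = is_origin (letter s).
Proof.
apply/idP/idP => [/asboolP -> |/asboolP s0]; first exact/asboolP.
apply/asboolP/orbit_word_ext/functional_extensionality_dep => i.
by apply: val_inj; rewrite /= s0.
Qed.

Lemma lamps_walk y l (s : orbit_word m) :
  lamps (walk y l) s = lamp_config (b := b) (word_of y l) (letter s).
Proof.
elim: y l s => [|[k t] y IH] [|[p q] l] s //=.
rewrite IH /= !orbit_eq_origin /= !mul1g !mulg1.
case: k; rewrite /gen_aut /= ?letters_act1 -mulgA.
  by rewrite is_origin_prop.
by rewrite if_same mul1g.
Qed.

(** Letters act by automorphisms whose inverses preserve finite support. *)
Lemma finsupp_letter (g : token M Lam) (s : letters (mseq M b)) :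
  Defs.finsupp (letters_act s (letter_aut b g)) -> Defs.finsupp s.
Proof.
move=> sg; rewrite -(letters_act1 s) -(mulgV (letter_aut b g)) letters_actM.
case: g sg => [t|t a|a] sg /=.
- by rewrite rootedV; exact: finsupp_rooted.
- by rewrite propagatingV; exact: finsupp_propagating.
- by rewrite invg1 letters_act1.
Qed.

(** A site in another orbit is never brought to the origin. *)
Lemma lamp_config_finsupp (V : seq (token M Lam)) s :
  ~ Defs.finsupp s -> lamp_config (b := b) V s = 1%g.
Proof.
elim: V s => //= g V IH s ns; rewrite IH; last by move=> /finsupp_letter.
case: ifP => [/asboolP s0|_]; last by rewrite mul1g.
by case: ns; exists 0.
Qed.

Lemma avg_lamps_word_of n y (Phi : seq (token M Lam) -> R) : size y = n ->
  avgn n (fun l => Phi (word_of y l)) =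
  avg_lamps (word_of y (nseq n (1%g, 1%g))) Phi.
Proof.
elim: n y Phi => [|n IH] [|[k t] y] Phi //= [yn].
case: k => /=; rewrite avg_pair; apply: eq_avg => p; apply: eq_avg => q.
  exact: (IH y (fun V => Phi [:: Lp M p, Pr t q & V])).
exact: (IH y (fun V => Phi [:: Lp M p, Sy Lam t, Lp M q & V])).
Qed.

Let M_gt1 : (1 < M)%N := ltnW M_gt2.

(** The walk on the uniform space of coins, seeds and lamps. *)
Definition finite_walk n :=
  (fun c => @walk_of M M_gt2 b Lam c.1 c.2) \o @finite_sample M M_gt2 b Lam n.

Lemma card_seeds_gt0 n : (0 < #|{: n.-tuple (bool * seed)}|)%N.
Proof.
rewrite card_tuple expn_gt0 (_ : 0 < _)%N//.
by apply/card_gt0P; exists (true, 1%g).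
Qed.

Lemma card_lamps_gt0 n : (0 < #|{: n.-tuple (Lam * Lam)}|)%N.
Proof.
rewrite card_tuple expn_gt0 (_ : 0 < _)%N//.
by apply/card_gt0P; exists 1%g.
Qed.

(** The code of the word of the walk determines its sections, hence its group
    element and its lamps. *)
Lemma fentropy_walk_le n :
  fentropy R (@finite_walk n) <=
  ln (2 * #|symbol M Lam|%:R) * avgn n (fun y : seq (bool * seed) => (code_size n b y)%:R) + ln 2.
Proof.
pose cd (w : n.-tuple (bool * seed) * n.-tuple (Lam * Lam)) :=
  code n b (word_of w.1 w.2).
have -> : avgn n (fun y : seq (bool * seed) => (code_size n b y)%:R) =
    avg (fun w => (size (cd w))%:R) :> R.
  rewrite avgnE avg_pair; apply: eq_avg => y.
  rewrite -[LHS](avg_cst _ (card_lamps_gt0 n)); apply: eq_avg => l.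
  by rewrite /cd size_code kind_seed_word_of ?size_tuple.
apply: fentropy_code.
- by rewrite card_prod muln_gt0 card_seeds_gt0 card_lamps_gt0.
- by apply/card_gt0P; exists (inl 1%g).
move=> [y l] [y' l']; rewrite /cd /= => cc.
have sz (u : n.-tuple (bool * seed)) (v : n.-tuple (Lam * Lam)) :
    (size (kind_seed (word_of u v)) <= n)%N.
  by rewrite kind_seed_word_of ?size_tuple.
have [_ [wa la]] := code_inj (r := [::]) (r' := [::]) M_gt1 (sz y l) (sz y' l')
  (congr1 (cat^~ [::]) cc).
apply: wreath_ext => [s|]; first by rewrite !lamps_walk.
apply: val_inj; rewrite [LHS]base_walk [RHS]base_walk.
exact: aut_ext.
Qed.

Hypothesis Lam_gt1 : (1 < #|Lam|)%N.

(** Condition on the coins and seeds: the lamps are then spread over the visited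
    sites, of which there is at least one below each visited vertex. *)
Lemma fentropy_walk_ge n k :
  ln 2 * avgn n (fun y : seq (bool * seed) =>
      (num_visited k b (word_of y (nseq n (1%g, 1%g))))%:R) <=
  fentropy R (@finite_walk n).
Proof.
rewrite avgnE; apply: (fentropy_cond (X := @finite_walk n)
  (N := fun y : n.-tuple (bool * seed) => num_visited k b (word_of y (nseq n (1%g, 1%g))))).
- exact: card_seeds_gt0.
- exact: card_lamps_gt0.
move=> y x.
pose F (s : letters (mseq M b)) : Lam :=
  if pselect (Defs.finsupp s) is left fs then lamps x (OrbitWord fs) else 1%g.
apply: le_trans (avg_lamps_le R M_gt1 Lam_gt1 k _ F).
rewrite -(@avg_lamps_word_of n y) ?size_tuple// avgnE; apply: ler_avg => l.
rewrite ler_nat; case: eqP => // yx; rewrite lt0b; apply/asboolP => s.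
rewrite /F; case: pselect => [fs|ns]; last exact: lamp_config_finsupp.
by rewrite -yx /finite_walk /= lamps_walk.
Qed.

End WalkEntropy.

Theorem theorem3 (R : realType) (gamma : R) (hgamma : 2^-1 <= gamma < 1) :
  exists c C : R, [/\ 0 < c, c <= C &
    forall f : R -> R,
      (forall x, 0 <= x -> 0 <= f x) ->
      f 1 = 1 ->
      (forall a n : R, 1 <= a -> 1 <= n ->
        a `^ 2^-1 * f n <= f (a * n) <= a `^ gamma * f n) ->
      exists m : degseq,
        forall (d : measure_display) (T : measurableType d)
          (P : probability T R)
          (L : nat -> T -> 'Z_2) (G : nat -> T -> mother m)
          (L' : nat -> T -> 'Z_2),
          sws_steps P (uniform_on R [set: 'Z_2]%classic) (@mother_law R m) L G L' ->
          forall n : nat, (1 <= n)%N ->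
            ((c * f n%:R)%:E <=
               entropy P (sws_walk (mother_act m) (origin m) L G L' n)
             <= (C * f n%:R)%:E)%E].
Proof.
have [M [M_gt2 M_large]] := large_degree hgamma.
have M_gt1 := ltnW M_gt2.
have M1 : 1 <= M%:R :> R by rewrite ler1n ltnW.
have M2 : 1 <= M%:R ^+ 2 :> R by rewrite exprn_ege1.
have l2 : 0 < ln 2 :> R by rewrite ln_gt0// ltr1n.
pose B : R := ln (2 * #|symbol M 'Z_2|%:R) * (M%:R * (2 + M%:R ^+ 4)).
have Z2_gt1 : (1 < #|'Z_2|)%N by rewrite card_ord.
have S1 : (1 <= #|symbol M 'Z_2|)%N by apply/card_gt0P; exists (inl 1%g).
have lS : 0 <= ln (2 * #|symbol M 'Z_2|%:R) :> R.
  by rewrite ln_ge0// -natrM ler1n muln_gt0.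
have B0 : 0 <= B by rewrite !mulr_ge0// addr_ge0// exprn_ge0.
(* [96 = 16 * 6]: the [16] of [greedy_lower] and the [6] of [mean_alive]. The same
   constant serves the small [n], where [f n <= 5] and the first lamp alone has
   entropy [ln 2]. *)
exists (ln 2 / (96 * M%:R ^+ 2)), (B + ln 2); split.
- by rewrite divr_gt0// mulr_gt0//; lra.
- apply: (@le_trans _ _ (ln 2)); last by rewrite lerDr.
  by rewrite ler_pdivrMr ?ler_peMr//; [exact: ltW|lra|lra].
move=> f _ f1 fg.
pose b := greedy M f; exists (mdegseq M_gt2 b) => d T P L G L' steps n n1.
have entE : entropy P (sws_walk (mother_act (mdegseq M_gt2 b)) (origin (mdegseq M_gt2 b)) L G L' n)
    = (fentropy R (@finite_walk M M_gt2 b 'Z_2 n))%:E.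
  apply: entropy_finite => [|x]; last exact: walk_law.
  by rewrite card_prod muln_gt0 card_seeds_gt0 card_lamps_gt0.
have n1' : 1 <= n%:R :> R by rewrite ler1n.
have fn1 : 1 <= f n%:R by have := growth_mono f1 fg (lexx 1) n1'; rewrite f1.
rewrite entE !lee_fin; apply/andP; split.
  have ge := fentropy_walk_ge R M_gt2 b (Lam := 'Z_2) Z2_gt1 n.
  have reach N : f n%:R <= 16 * M%:R ^+ 2 * (6 * N) -> forall k,
      N <= avgn n (fun y : seq (bool * ('S_2 * 'S_M)) =>
        (num_visited k b (word_of y (nseq n (1%g : 'Z_2, 1%g))))%:R) ->
      ln 2 / (96 * M%:R ^+ 2) * f n%:R <= fentropy R (@finite_walk M M_gt2 b 'Z_2 n).
    move=> fN k Nk; apply: le_trans (ge k).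
    apply: (@le_trans _ _ (ln 2 * N)); last by rewrite ler_pM2l.
    rewrite -mulrA ler_pM2l//.
    rewrite mulrC ler_pdivrMr; last by lra.
    by apply: (le_trans fN); rewrite le_eqVlt; apply/orP; left; apply/eqP; ring.
  have [f5|[k [dk fk]]] := greedy_lower hgamma M_gt2 M_large f1 fg n1.
    apply: (reach 1 _ 0%N); first lra.
    rewrite -[leLHS](avgn_cst (A := (bool * ('S_2 * 'S_M))%type) n).
      apply: ler_avgn => y yn; rewrite ler1n /num_visited /= addn0.
      by case: n y yn n1 {ge reach entE fn1 n1' f5} => // n [|[[] t] y].
    by apply/card_gt0P; exists (true, 1%g).
  apply: (reach (width R M k b / 6) _ k); first lra.
  apply: (le_trans (mean_alive M_gt1 dk)); apply: ler_avgn => y yn.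
  rewrite ler_nat; apply: leq_trans (alive_le_num_visited k b _).
  by rewrite kind_seed_word_of// size_nseq.
apply: (le_trans (fentropy_walk_le R M_gt2 b 'Z_2 n)).
rewrite [leRHS]mulrDl; apply: lerD; last by rewrite ler_peMr// ltW.
rewrite -mulrA ler_wpM2l//.
have [k hk] := greedy_upper hgamma M_gt2 M_large f1 fg n1.
exact: le_trans (mean_code R M_gt1 n k n b) hk.
Qed.
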